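(* For $n\geq1$, with $N_n(t,q,r)=\sum_{\sigma\in\mathfrak{S}_n(321)}t^{\mathsf{exc}\,\sigma}q^{\mathsf{inv}\,\sigma}r^{\mathsf{fix}\,\sigma}$, $$N_n(t/q, q, 1)=\sum_{k=0}^{\lfloor \frac{n-1}{2}\rfloor}\gamma_{n-1, k}(q)t^k(1+t)^{n-1-2k},$$ where $$\gamma_{n-1, k}(q)=\sum_{\pi\in\widetilde{\mathfrak{S}}_{n-1,k}(321)}q^{\mathsf{inv}\,\pi}=\sum_{\pi\in\widetilde{\mathfrak{S}}_{n-1,k}(231)}q^{(31\text{-}2)\pi+\mathsf{des}\,\pi}=\sum_{\pi\in\widetilde{\mathfrak{S}}_{n-1,k}(312)}q^{(2\text{-}31)\pi+\mathsf{des}\,\pi}=\sum_{\pi\in\widetilde{\mathfrak{S}}_{n-1,k}(132)}q^{(2\text{-}13)\pi+\mathsf{asc}\,\pi}=\sum_{\pi\in\widetilde{\mathfrak{S}}_{n-1,k}(213)}q^{(13\text{-}2)\pi+\mathsf{asc}\,\pi}.$$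
   Context: $\mathfrak{S}_m(\tau)$ is the set of permutations of $[m]$ avoiding the classical pattern $\tau$. For $\sigma\in\mathfrak{S}_m$: $\mathsf{exc},\mathsf{fix},\mathsf{inv}$ are the numbers of excedances ($\sigma(i)>i$), fixed points and inversions; $\mathsf{des}\,\sigma=\#\{i\in[m-1]:\sigma(i)>\sigma(i+1)\}$, $\mathsf{asc}\,\sigma=\#\{i\in[m-1]:\sigma(i)<\sigma(i+1)\}$. $(31\text{-}2)\sigma=\#\{(i,j):i+1<j\le m,\ \sigma(i+1)<\sigma(j)<\sigma(i)\}$, $(2\text{-}31)\sigma=\#\{(i,j):j<i<m,\ \sigma(i+1)<\sigma(j)<\sigma(i)\}$, $(2\text{-}13)\sigma=\#\{(i,j):j<i<m,\ \sigma(i)<\sigma(j)<\sigma(i+1)\}$, $(13\text{-}2)\sigma=\#\{(i,j):i+1<j\le m,\ \sigma(i)<\sigma(j)<\sigma(i+1)\}$. $\mathsf{cda}\,\sigma$ is the number of values $x$ with $\sigma^{-1}(x)<x<\sigma(x)$. $\mathsf{ldd}\,\sigma$ is the number of $i\in[m]$ with $\sigma(i-1)>\sigma(i)>\sigma(i+1)$ under the convention $\sigma(0)=0,\sigma(m+1)=\infty$; $\mathsf{rda}\,\sigma$ is the number of $i\in[m]$ with $\sigma(i-1)<\sigma(i)<\sigma(i+1)$ under the convention $\sigma(0)=\infty,\sigma(m+1)=0$. For $0\le k\le m$: $\widetilde{\mathfrak{S}}_{m,k}(321)=\{\sigma\in\mathfrak{S}_m(321):\mathsf{exc}\,\sigma=k,\mathsf{cda}\,\sigma=0\}$,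 $\widetilde{\mathfrak{S}}_{m,k}(213)=\{\sigma\in\mathfrak{S}_m(213):\mathsf{asc}\,\sigma=k,\mathsf{rda}\,\sigma=0\}$, $\widetilde{\mathfrak{S}}_{m,k}(312)=\{\sigma\in\mathfrak{S}_m(312):\mathsf{des}\,\sigma=k,\mathsf{ldd}\,\sigma=0\}$, $\widetilde{\mathfrak{S}}_{m,k}(132)=\{\sigma\in\mathfrak{S}_m(132):\mathsf{asc}\,\sigma=k,\mathsf{rda}\,\sigma=0\}$, $\widetilde{\mathfrak{S}}_{m,k}(231)=\{\sigma\in\mathfrak{S}_m(231):\mathsf{des}\,\sigma=k,\mathsf{ldd}\,\sigma=0\}$. *)

(* Defs.v *)
(* Permutations of [m] are modelled as 'S_m = {perm 'I_m}
   (positions and values 0-indexed; all statistics are shift invariant,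
   and the boundary conventions of ldd/rda are encoded with an explicit
   padded word using values 1..m). *)
From HB Require Import structures.
From mathcomp Require Import all_boot all_order all_algebra all_fingroup.
Set Implicit Arguments. Unset Strict Implicit. Unset Printing Implicit Defensive.
Import GRing.Theory.

Definition word m (s : 'S_m) : seq nat := [seq val (s i) | i <- enum 'I_m].
Definition wv m (s : 'S_m) (i : nat) : nat := nth 0 (word s) i.

Definition occurs_at m (s : 'S_m) (tau : seq nat)
    (f : {ffun 'I_(size tau) -> 'I_m}) : bool :=
  [forall a : 'I_(size tau), forall b : 'I_(size tau),
     ((a < b)%N ==> (f a < f b)%N) &&
     ((s (f a) < s (f b))%N == (nth 0 tau a < nth 0 tau b)%N)].
Definition contains m (s : 'S_m) (tau : seq nat) : bool :=
  [exists f, @occurs_at m s tau f].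
Definition avoids m (s : 'S_m) (tau : seq nat) : bool := ~~ contains s tau.

Definition exc m (s : 'S_m) : nat := #|[set i : 'I_m | (i < s i)%N]|.
Definition fixp m (s : 'S_m) : nat := #|[set i : 'I_m | s i == i]|.
Definition inv m (s : 'S_m) : nat :=
  \sum_(i < m) \sum_(j < m) ((i < j)%N && (s j < s i)%N).
Definition des m (s : 'S_m) : nat :=
  \sum_(0 <= i < m.-1) (wv s i.+1 < wv s i)%N.
Definition asc m (s : 'S_m) : nat :=
  \sum_(0 <= i < m.-1) (wv s i < wv s i.+1)%N.

Definition p31_2 m (s : 'S_m) : nat :=
  \sum_(p < m) \sum_(r < m)
    [&& (p.+1 < r)%N, (wv s p.+1 < wv s r)%N & (wv s r < wv s p)%N].
Definition p2_31 m (s : 'S_m) : nat :=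
  \sum_(p < m) \sum_(r < m)
    [&& (r < p)%N, (p.+1 < m)%N, (wv s p.+1 < wv s r)%N & (wv s r < wv s p)%N].
Definition p2_13 m (s : 'S_m) : nat :=
  \sum_(p < m) \sum_(r < m)
    [&& (r < p)%N, (p.+1 < m)%N, (wv s p < wv s r)%N & (wv s r < wv s p.+1)%N].
Definition p13_2 m (s : 'S_m) : nat :=
  \sum_(p < m) \sum_(r < m)
    [&& (p.+1 < r)%N, (wv s p < wv s r)%N & (wv s r < wv s p.+1)%N].

Definition cda m (s : 'S_m) : nat :=
  #|[set x : 'I_m | ((s^-1)%g x < x)%N && (x < s x)%N]|.

Definition padL m (s : 'S_m) : seq nat := 0 :: [seq v.+1 | v <- word s] ++ [:: m.+1].
Definition padR m (s : 'S_m) : seq nat := m.+1 :: [seq v.+1 | v <- word s] ++ [:: 0].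
(* sigma(0)=0, sigma(m+1)=infinity (m+1 exceeds every value) *)
Definition ldd m (s : 'S_m) : nat :=
  \sum_(1 <= i < m.+1)
    [&& (nth 0 (padL s) i < nth 0 (padL s) i.-1)%N
      & (nth 0 (padL s) i.+1 < nth 0 (padL s) i)%N].
(* sigma(0)=infinity, sigma(m+1)=0 *)
Definition rda m (s : 'S_m) : nat :=
  \sum_(1 <= i < m.+1)
    [&& (nth 0 (padR s) i.-1 < nth 0 (padR s) i)%N
      & (nth 0 (padR s) i < nth 0 (padR s) i.+1)%N].

Definition Stilde321 m k : {set 'S_m} :=
  [set s | avoids s [:: 3; 2; 1] & (exc s == k) && (cda s == 0)].
Definition Stilde213 m k : {set 'S_m} :=
  [set s | avoids s [:: 2; 1; 3] & (asc s == k) && (rda s == 0)].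
Definition Stilde312 m k : {set 'S_m} :=
  [set s | avoids s [:: 3; 1; 2] & (des s == k) && (ldd s == 0)].
Definition Stilde132 m k : {set 'S_m} :=
  [set s | avoids s [:: 1; 3; 2] & (asc s == k) && (rda s == 0)].
Definition Stilde231 m k : {set 'S_m} :=
  [set s | avoids s [:: 2; 3; 1] & (des s == k) && (ldd s == 0)].

Local Open Scope ring_scope.

Definition Nn_shift (R : comUnitRingType) n (t q : R) : R :=
  \sum_(s : 'S_n | avoids s [:: 3; 2; 1])
     (t * q^-1) ^+ exc s * q ^+ inv s * 1 ^+ fixp s.

Definition gamma (R : comUnitRingType) m k (q : R) : R :=
  \sum_(s in Stilde321 m k) q ^+ inv s.

(* Main.v *)
(** A 321-avoiding permutation is determined by the sets I of its excedance
positions and J of its excedance values, so scanning x = 1, ..., n and recording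
whether x lies in I and in J gives a 2-coloured Motzkin path; inv - exc is a sum
of heights, and cda counts the x lying in both sets. Cutting each step of the path
in two halves and regrouping the halves gives paths one step shorter, in which
both kinds of level steps are allowed at every height: the level steps
then contribute the powers of 1 + t, and the uncoloured paths give the gamma's.
In the same way, the descent bottoms I and descent tops J of a 231-avoiding
permutation without double descents give an uncoloured Motzkin path, along which
the heights add up to the sum of the drops s(i) - s(i+1) over the descents.
Every permutation satisfies (31-2) + (2-31) + des = sum of the drops, and one of
the first two terms vanishes when 231 or 312 is avoided; the remaining classes
are obtained by complement and reverse-complement. *)
Require Import Defs.
From mathcomp Require Import all_boot all_order all_algebra all_fingroup.
From mathcomp Require Import zify ring.
Import GRing.Theory.
Local Open Scope ring_scope.
Set Implicit Arguments. Unset Strict Implicit. Unset Printing Implicit Defensive.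

(** * Weighted Motzkin paths *)

Section Motzkin.
Variable R : comNzRingType.

(* Paths of length [m] from height [h] to height [0]; [dn h] is the weight of a
   step from [h.+1] to [h]. *)
Fixpoint motz (up lev dn : nat -> R) (m h : nat) : R :=
  if m is m'.+1 then
    lev h * motz up lev dn m' h + up h * motz up lev dn m' h.+1
    + (if h is h'.+1 then dn h' * motz up lev dn m' h' else 0)
  else (h == 0%N)%:R.

Lemma motzS up lev dn m h :
  motz up lev dn m.+1 h = lev h * motz up lev dn m h + up h * motz up lev dn m h.+1
    + (if h is h'.+1 then dn h' * motz up lev dn m h' else 0).
Proof. by []. Qed.

Lemma eq_motz (up up' lev lev' dn dn' : nat -> R) :
  up =1 up' -> lev =1 lev' -> dn =1 dn' ->
  motz up lev dn =2 motz up' lev' dn'.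
Proof.
move=> eu el ed; elim=> [|m IH] h //=; rewrite eu el !IH.
by case: h => [|h] //; rewrite ed IH.
Qed.

(* Regrouping of the half steps of a path. *)
Lemma motz_shift (t q : R) (m h : nat) :
  motz (fun h => t * q ^+ h)
       (fun h => q ^+ h + (if h is h'.+1 then t * q ^+ h' else 0))
       (fun h => q ^+ h) m.+1 h =
  let Q := motz (fun h => t * q ^+ h.+1) (fun h => (1 + t) * q ^+ h)
                (fun h => q ^+ h) m in
  q ^+ h * Q h + (if h is h'.+1 then q ^+ h' * Q h' else 0).
Proof.
elim: m h => [|m IH] h.
  by case: h => [|[|h]] /=; ring.
(* The right-hand side looks one level down and its recurrence one level further, so [h = 0] and
   [h = 1] are separate cases. *)
case: h => [|[|h]]; rewrite motzS ?IH; cbv zeta; rewrite !motzS.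
- by ring.
- by ring.
- by rewrite !exprS; ring.
Qed.

Lemma motz_gt (up lev dn : nat -> R) m h : (m < h)%N -> motz up lev dn m h = 0.
Proof.
elim: m h => [|m IH] [|h] //= lt_mh.
by rewrite !IH ?mulr0 ?addr0 //; lia.
Qed.

End Motzkin.

(** * Homogeneity in the weights of rises and level steps *)

Section Homogeneity.
Variable R : comNzRingType.
Variables (q t l : R).

(** The indeterminate marks the rises; at [h = 0] the coefficients turn out to be the
    [gamma m k q]. *)
Definition motzX : nat -> nat -> {poly R} :=
  motz (fun h => 'X * (q%:P) ^+ h.+1) (fun h => (q%:P) ^+ h) (fun h => (q%:P) ^+ h).

Lemma coef_motzXS m h k :
  (motzX m.+1 h)`_k = q ^+ h * (motzX m h)`_k
    + (if k is k'.+1 then q ^+ h.+1 * (motzX m h.+1)`_k' else 0)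
    + (if h is h'.+1 then q ^+ h' * (motzX m h')`_k else 0).
Proof.
rewrite /motzX /= -!rmorphXn /= !coefD coefCM; congr (_ + _ + _).
  rewrite -mulrA coefXM; case: k => //= k; by rewrite coefCM.
by case: h => [|h]; rewrite ?coef0 // -rmorphXn /= coefCM.
Qed.

(** A path with [k] rises from height [h] to [0] has [h + k] falls, hence at least [h + k.*2]
    steps. *)
Lemma coef_motzX_gt m h k : (m < h + k.*2)%N -> (motzX m h)`_k = 0.
Proof.
elim: m h k => [|m IH] h k lt_m.
  rewrite /motzX /=; case: eqP => [h0|_]; rewrite ?coef0 // coef1; case: k lt_m => //=; lia.
rewrite coef_motzXS IH; last lia.
have -> : (if k is k'.+1 then q ^+ h.+1 * (motzX m h.+1)`_k' else 0) = 0.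
  by case: k lt_m => // k lt_m; rewrite IH ?mulr0 //; lia.
by case: h lt_m => [|h] lt_m; rewrite ?IH; rewrite ?mulr0 ?addr0 //; lia.
Qed.

(** A path with [k] rises has [h + k] falls and thus [m - h - k.*2] level steps. Where this
    subtraction is truncated, the coefficient vanishes. *)
Lemma motz_homog m h K : (m < K.*2)%N ->
  motz (fun h => t * q ^+ h.+1) (fun h => l * q ^+ h) (fun h => q ^+ h) m h =
  \sum_(k < K) (motzX m h)`_k * t ^+ k * l ^+ (m - h - k.*2).
Proof.
elim: m h K => [|m IH] h K lt_m.
  case: K lt_m => // K _; rewrite big_ord_recl big1 /= => [|i _].
    by rewrite /motzX /=; case: h => [|h] /=; rewrite ?coef1 ?coef0 /=; ring.
  by rewrite coef_motzX_gt ?mul0r //= /bump; lia.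
case: K lt_m => // K lt_m.
rewrite motzS (IH h K.+1); last lia.
have -> : \sum_(k < K.+1) (motzX m.+1 h)`_k * t ^+ k * l ^+ (m.+1 - h - k.*2) =
  \sum_(k < K.+1) (q ^+ h * (motzX m h)`_k) * t ^+ k * l ^+ (m.+1 - h - k.*2) +
  \sum_(k < K.+1) (if k : nat is k'.+1 then q ^+ h.+1 * (motzX m h.+1)`_k' else 0) * t ^+ k * l ^+ (m.+1 - h - k.*2) +
  \sum_(k < K.+1) (if h is h'.+1 then q ^+ h' * (motzX m h')`_k else 0) * t ^+ k * l ^+ (m.+1 - h - k.*2).
  rewrite -!big_split; apply: eq_bigr => k _ /=.
  by rewrite coef_motzXS !mulrDl.
congr (_ + _ + _).
- rewrite mulr_sumr; apply: eq_bigr => k _.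
  have [le_m|lt_m'] := leqP (h + k.*2) m; last by rewrite coef_motzX_gt //; ring.
  have -> : (m.+1 - h - k.*2 = (m - h - k.*2).+1)%N by lia.
  by rewrite exprS; ring.
- rewrite big_ord_recl /= !mul0r add0r.
  have [K0|K_gt0] := posnP K.
    subst K; rewrite big_ord0 motz_gt ?mulr0 //; lia.
  have [lt_mK|le_Km] := ltnP m K.*2.
    rewrite (IH h.+1 K) // mulr_sumr; apply: eq_bigr => k _ /=.
    have -> : (m.+1 - h - (bump 0 k).*2 = (m - h.+1 - k.*2))%N by rewrite /bump; lia.
    by rewrite /bump leq0n add1n (exprS t); ring.
  (* Here [m = K.*2]. One more term is allowed, and it vanishes: [K] rises from height [h.+1] need
     more than [m] steps. *)
  rewrite (IH h.+1 K.+1); last lia.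
  rewrite big_ord_recr /= coef_motzX_gt; last lia.
  rewrite !mul0r addr0 mulr_sumr; apply: eq_bigr => k _ /=.
  have -> : (m.+1 - h - (bump 0 k).*2 = (m - h.+1 - k.*2))%N by rewrite /bump; lia.
  by rewrite /bump leq0n add1n (exprS t); ring.
- case: h => [|h]; first by rewrite big1 // => k _; rewrite !mul0r.
  rewrite (IH h K.+1); last lia.
  rewrite mulr_sumr; apply: eq_bigr => k _.
  by rewrite subSS; ring.
Qed.

End Homogeneity.

(** * Permutations avoiding 321 *)

Local Open Scope nat_scope.

Definition av3 (P : nat -> nat -> nat -> bool) (w : seq nat) : Prop :=
  forall x y z, subseq [:: x; y; z] w -> ~~ P x y z.

Lemma av3_subseq P v w : subseq v w -> av3 P w -> av3 P v.
Proof. by move=> sub_vw av_w x y z /subseq_trans/(_ sub_vw); apply: av_w. Qed.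

Lemma subseq_insert (T : eqType) (t u v : seq T) s :
  subseq t (u ++ s :: v) ->
  subseq t (u ++ v) \/
  exists t1 t2, [/\ t = t1 ++ s :: t2, subseq t1 u & subseq t2 v].
Proof.
elim: u t => [|a u IH] [|b t]; rewrite ?sub0seq ?cat0s; try by left.
  rewrite /=; case: eqP => [-> | _] sub_tv; last by left.
  by right; exists [::], t.
rewrite !cat_cons /=; case: eqP => [-> | _] /IH [sub_t | [t1 [t2 [-> ? ?]]]].
- by left.
- by right; exists (a :: t1), t2; rewrite /= eqxx.
- by left.
- right; exists t1, t2; split=> //; exact: subseq_trans (subseq_cons _ _).
Qed.

Lemma subseq3_insert (x y z s : nat) u v :
  subseq [:: x; y; z] (u ++ s :: v) ->
  [\/ subseq [:: x; y; z] (u ++ v), x = s /\ subseq [:: y; z] v,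
      [/\ y = s, x \in u & z \in v] | z = s /\ subseq [:: x; y] u].
Proof.
case/subseq_insert => [|[t1 [t2 [def_t sub1 sub2]]]]; first by move=> ?; constructor 1.
case: t1 def_t sub1 => [[-> def_t2]|a [[ea eb et]|b [[ea eb ec et]|c [|? ?] //]]] sub1.
- by constructor 2; rewrite def_t2.
- by constructor 3; rewrite -sub1seq ea eb sub1 -sub1seq et.
- by constructor 4; rewrite ea eb ec.
Qed.

Lemma sub2_mem (x y : nat) w : subseq [:: x; y] w -> (x \in w) /\ (y \in w).
Proof. by move/mem_subseq=> H; rewrite !H ?inE ?eqxx ?orbT. Qed.

Lemma sub3_mem (x y z : nat) w : subseq [:: x; y; z] w -> [/\ x \in w, y \in w & z \in w].
Proof. by move/mem_subseq=> H; rewrite !H ?inE ?eqxx ?orbT. Qed.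

Lemma sub2_ltn (x y : nat) w : sorted ltn w -> subseq [:: x; y] w -> x < y.
Proof. by move=> sw /subseq_sorted/(_ sw) => /(_ ltn_trans) /= /andP []. Qed.

Lemma sub2_gtn (x y : nat) w : sorted gtn w -> subseq [:: x; y] w -> y < x.
Proof. by move=> sw /subseq_sorted/(_ sw) => /(_ (rev_trans ltn_trans)) /= /andP []. Qed.

Definition is321 x y z := (z < y) && (y < x).

Lemma av321F w x y z : av3 is321 w -> subseq [:: x; y; z] w -> z < y -> y < x -> False.
Proof. by move=> av /av /negP H zy yx; apply: H; apply/andP. Qed.

(* A state records how the values [lo, ...] extend a partial 321-avoiding
   permutation: [st] are the values below [lo] not yet placed, [u.1] the values
   (in decreasing order) at the positions below [lo] not yet filled, [u.2] the
   word in the positions from [lo] on; the word still to be completed is thus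
   [catrev u.1 u.2]. The four parts of the list correspond to [lo] being neither
   an excedance position nor an excedance value, only a position, both, only a
   value. *)
Fixpoint states321 (m lo : nat) (st : seq nat) : seq (seq nat * seq nat) :=
  if m is m'.+1 then
    [seq (u.1, head lo st :: u.2) | u <- states321 m' lo.+1 (behead (rcons st lo))]
    ++ ([seq (behead u.1, head 0 u.1 :: u.2) | u <- states321 m' lo.+1 (rcons st lo)]
    ++ (if st is s :: st' then
         [seq (rcons (behead u.1) lo, head 0 u.1 :: u.2) | u <- states321 m' lo.+1 st]
         ++ [seq (rcons u.1 lo, s :: u.2) | u <- states321 m' lo.+1 st']
       else [::]))
  else if st is [::] then [:: ([::], [::])] else [::].

(** The open positions below [lo] receive values from [lo] on, so they are excedances, which
    increase from left to right when 321 is avoided; [u.1] lists them in reverse. *)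
Definition state321 (m lo : nat) (st : seq nat) (u : seq nat * seq nat) : Prop :=
  [/\ size u.1 = size st, perm_eq (u.1 ++ u.2) (st ++ iota lo m),
      sorted gtn u.1, all (leq lo) u.1 & av3 is321 (catrev u.1 u.2)].

Definition pending (lo : nat) (st : seq nat) := sorted ltn st && all (gtn lo) st.

Lemma pending_rcons lo st : pending lo st -> pending lo.+1 (rcons st lo).
Proof.
case/andP=> sst ast; rewrite /pending all_rcons /= ltnSn /=.
apply/andP; split; last by apply: sub_all ast => x /= ; lia.
case: st sst ast => //= x st; rewrite rcons_path => -> /= /andP [xlo ast].
have /allP H : all (gtn lo) (x :: st) by rewrite /= xlo.
by apply: H; apply: mem_last.
Qed.

Lemma pending_behead lo st : pending lo st -> pending lo (behead st).
Proof.
by case: st => //= x st /andP [/= /path_sorted sst] /andP [_ ast]; apply/andP.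
Qed.

Lemma pending_cons lo x st : pending lo (x :: st) -> pending lo st.
Proof. exact: pending_behead. Qed.

Lemma pendingS lo st : pending lo st -> pending lo.+1 st.
Proof.
case/andP=> sst ast; rewrite /pending sst /=.
by apply: sub_all ast => x /=; lia.
Qed.

Lemma pending_lt lo st x : pending lo st -> x \in st -> x < lo.
Proof. by case/andP => _ /allP H /H. Qed.

Lemma pending_min lo s st x : pending lo (s :: st) -> x \in st -> s < x.
Proof.
by case/andP => /=; rewrite path_sortedE; [case/andP=> /allP H _ _ /H | exact: ltn_trans].
Qed.

Lemma state321_uniq m lo st u : pending lo st -> state321 m lo st u -> uniq (u.1 ++ u.2).
Proof.
move=> pst [_ /perm_uniq -> _ _ _]; rewrite cat_uniq iota_uniq andbT.
case/andP: (pst) => sst _; rewrite (sorted_uniq ltn_trans ltnn sst) /=.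
by apply/hasPn => x; rewrite mem_iota => /andP [lox _]; apply/negP => /(pending_lt pst); lia.
Qed.

Lemma state321_mem m lo st u : state321 m lo st u ->
  forall x, (x \in u.1 ++ u.2) = (x \in st) || (lo <= x < lo + m).
Proof. by case=> _ /perm_mem H _ _ _ x; rewrite H mem_cat mem_iota. Qed.

(** The smallest letter can only be the last one of a 321, but the letters before it increase. *)
Lemma av321_insert_min s rs w :
  sorted gtn rs -> {in rs ++ w, forall x, s < x} ->
  av3 is321 (catrev rs w) -> av3 is321 (catrev rs (s :: w)).
Proof.
rewrite !catrevE => srs smin av x y z /subseq3_insert [].
- exact: av.
- case=> -> /sub2_mem [yw _]; have := smin y; rewrite mem_cat yw orbT => /(_ isT).
  by rewrite /is321; lia.
- case=> -> _ zw; have := smin z; rewrite mem_cat zw orbT => /(_ isT).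
  by rewrite /is321; lia.
- case=> -> sub; have /(sub2_ltn _) -/(_ _) H := sub.
  have : sorted ltn (rev rs) by rewrite rev_sorted.
  by move=> /sub2_ltn /(_ sub); rewrite /is321; lia.
Qed.

(** In a 321 starting with [lo], the two other letters are below [lo], hence in [w]. An entry of
    [rs] could then replace [lo]; if there is none, [w] has no letter below [lo]. *)
Lemma av321_prepend lo rs w :
  all (leq lo) rs -> (rs = [::] -> {in w, forall x, lo <= x}) ->
  av3 is321 (catrev rs w) -> av3 is321 (lo :: catrev rs w).
Proof.
move=> ars rs0 av x y z; rewrite -[lo :: _]cat0s => /subseq3_insert [||[]|[]] //; first exact: av.
  rewrite catrevE => -[-> sub]; apply/negP => /andP [zy ylo].
  have yrs : y \notin rs by apply/negP => /(allP ars); lia.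
  have /= sub_w : subseq [:: y; z] w.
    move: sub; elim/last_ind: rs ars yrs {rs0 av} => //= rs r IH.
    rewrite all_rcons mem_rcons inE rev_rcons negb_or /= => /andP [_ ars] /andP [yr yrs].
    by rewrite (negPf yr); exact: IH.
  have [yw zw] := sub2_mem sub_w.
  case def_rs: rs => [|r rs'].
    by have := rs0 def_rs _ yw; lia.
  have lo_r : lo <= r by apply: (allP ars); rewrite def_rs inE eqxx.
  apply: (av321F (x := r) (y := y) (z := z) av) => //; last lia.
  rewrite catrevE def_rs rev_cons cat_rcons.
  by rewrite -[[:: r; y; z]]cat0s cat_subseq // ?sub0seq //= eqxx.
Qed.

Lemma sorted_gtn_rcons lo rs :
  sorted gtn rs -> all (leq lo.+1) rs -> sorted gtn (rcons rs lo).
Proof.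
case: rs => //= r rs srs /andP [lo_r ars]; rewrite rcons_path srs /=.
have /allP H : all (leq lo.+1) (r :: rs) by rewrite /= lo_r.
exact: H (mem_last _ _).
Qed.

Lemma sorted_gtn_last lo rs :
  sorted gtn rs -> all (leq lo) rs -> lo \in rs ->
  exists rs', [/\ rs = rcons rs' lo, sorted gtn rs' & all (leq lo.+1) rs'].
Proof.
case/lastP: rs => // rs x srs; rewrite all_rcons mem_rcons inE => /andP [lo_x _] lo_rs.
have gt_x y : y \in rs -> x < y.
  move=> yrs; apply: (sub2_gtn srs).
  by rewrite -cats1; apply: (@cat_subseq _ [:: y] [:: x]); rewrite sub1seq ?inE.
have E : lo = x.
  by case/orP: lo_rs => [/eqP //|/gt_x]; lia.
exists rs; split; first by rewrite E.
  by apply: (subseq_sorted (rev_trans ltn_trans)) srs; exact: subseq_rcons.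
by apply/allP => y /gt_x; rewrite E.
Qed.

Lemma subseq_catrev_cons (T : eqType) (s t : seq T) x :
  subseq (catrev s t) (catrev s (x :: t)).
Proof. by rewrite !catrevE cat_subseq ?subseq_cons. Qed.

Lemma catrev_rcons (T : Type) (s t : seq T) x : catrev (rcons s x) t = x :: catrev s t.
Proof. by rewrite !catrevE rev_rcons. Qed.

Lemma rcons_head (T : Type) (s : seq T) x : rcons s x = head x s :: behead (rcons s x).
Proof. by case: s. Qed.

Lemma perm_head_rcons (T : eqType) (s : seq T) x (p : pred T) :
  (p (head x s) + count p (behead (rcons s x)) = p x + count p s)%N.
Proof. by case: s => //= y s; rewrite -cats1 count_cat /=; lia. Qed.

(** Each extension inserts the smallest letter after an increasing prefix, moves the boundary
    between [u.1] and [u.2], puts [lo] in front, or combines two of these; none creates a 321. *)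
Lemma states321_sound m lo st u :
  pending lo st -> u \in states321 m lo st -> state321 m lo st u.
Proof.
elim: m lo st u => [|m IH] lo st u pst.
  by case: st pst => //= _; rewrite inE => /eqP ->; split.
rewrite /= !mem_cat => /or3P [/mapP [[rs w]] | /mapP [[rs w]] | ].
(* The value [lo] joins the pending ones, and the smallest of them, [lo] itself if [st] is empty,
   goes to position [lo]. *)
- have pst' := pending_rcons pst; rewrite rcons_head in pst'.
  move/IH=> /(_ (pending_cons pst')) St ->.
  case: (St); rewrite [u in u.1]/= => sz /seq.permP pm srs ars av; split=> //=.
  + by rewrite sz size_behead size_rcons.
  + apply/seq.permP=> p; have := pm p; have := perm_head_rcons st lo p.
    by rewrite !count_cat /=; lia.
  + by apply: sub_all ars => x; lia.
  apply: av321_insert_min => // x; rewrite (state321_mem St).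
  case/orP => [|lo_x]; first exact: (pending_min pst').
  by case/andP: pst' lo_x => _ /= /andP [h_lo _] /andP [lo_x _]; exact: leq_ltn_trans lo_x.
- move/IH=> /(_ (pending_rcons pst)) St ->.
  case: (St) => /=; rewrite size_rcons.
  case: rs {St} => //= r rs [sz] /seq.permP pm /path_sorted srs /andP [lo_r ars] av; split=> //=.
  + apply/seq.permP=> p; have := pm p; rewrite !count_cat /= -cats1 !count_cat /=; lia.
  + by apply: sub_all ars => x; lia.
case: st pst => // s st pst; rewrite mem_cat => /orP [] /mapP [[rs w]].
- move/IH=> /(_ (pendingS pst)) St ->.
  case: (St) => /=.
  case: rs {St} => //= r rs [sz] /seq.permP pm srs /andP [lo_r ars] av; split=> /=.
  + by rewrite size_rcons sz.
  + apply/seq.permP=> p; have := pm p; rewrite /= !count_cat /= -cats1 !count_cat /=; lia.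
  + by apply: sorted_gtn_rcons => //; exact: path_sorted srs.
  + by rewrite all_rcons leqnn; apply: sub_all ars => x; lia.
  rewrite catrev_rcons; apply: (av321_prepend (rs := r :: rs)) => //=.
  by rewrite ltnW //; apply: sub_all ars => x; lia.
- move/IH=> /(_ (pendingS (pending_cons pst))) St ->.
  have M := state321_mem St.
  case: (St) => /= sz /seq.permP pm srs ars av.
  have srs' := sorted_gtn_rcons srs ars.
  split=> //=.
  + by rewrite size_rcons sz.
  + apply/seq.permP=> p; have := pm p; rewrite /= !count_cat /= -cats1 !count_cat /=; lia.
  + by rewrite all_rcons leqnn; apply: sub_all ars => x; lia.
  apply: av321_insert_min => //.
  + move=> x; rewrite mem_cat mem_rcons inE -orbA => /orP [/eqP ->|].
      by apply: (pending_lt pst); rewrite inE eqxx.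
    rewrite -mem_cat M => /orP [|lo_x]; first exact: (pending_min pst).
    have : s < lo by apply: (pending_lt pst); rewrite inE eqxx.
    by lia.
  rewrite catrev_rcons; apply: av321_prepend => //=.
    by apply: sub_all ars => x; lia.
  move=> rs0 x xw; move: (M x); rewrite mem_cat /= xw orbT => /esym /orP [|]; last lia.
  by move: sz; rewrite rs0; case: (st).
Qed.

(** The part of the list is read off from how the letter at position [lo] compares with [lo] and
    from whether [lo] lies in [u.1]; avoiding 321 keeps both pending lists in order. *)
Lemma states321_complete m lo st u :
  pending lo st -> state321 m lo st u -> u \in states321 m lo st.
Proof.
elim: m lo st u => [|m IH] lo st [rs w] pst St; have M := state321_mem St.
  case: St => /= sz /perm_size; rewrite cats0 size_cat sz => szw _ ars _.
  move: szw; rewrite -[RHS]addn0 => /addnI /size0nil w0.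
  move: sz ars; case def_rs: rs => [|r rs'] sz /= => [_|/andP [lo_r _]].
    by case: st sz {pst M} => //=; rewrite w0.
  have := M r; rewrite /= def_rs inE eqxx /= => /esym /orP [/(pending_lt pst)|]; lia.
have := state321_uniq pst St.
case: (St) => /= sz pm srs ars av.
case: w pm av M {St} => [|a w] pm av M Un.
  by move/perm_size: pm; rewrite !size_cat sz /= size_iota; lia.
have sub_av v : subseq v (catrev rs (a :: w)) -> av3 is321 v by move/av3_subseq; apply.
have a_rs : a \notin rs.
  by move: Un; rewrite cat_uniq => /and3P [_ /norP []].
have a_st : (a \in st) || (lo <= a < lo + m.+1) by rewrite -M mem_cat inE eqxx orbT.
have last_lo : lo \notin rs -> all (leq lo.+1) rs.
  move=> lo_rs; apply/allP => x xrs; have := allP ars x xrs.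
  by rewrite leq_eqVlt => /orP [/eqP E|//]; rewrite E xrs in lo_rs.
rewrite /= !mem_cat; have [a_lo|lo_a] := ltnP a lo.
  have {}a_st : a \in st by case/orP: a_st => //; lia.
  case: st pst sz pm M a_st => // s st pst sz pm M a_st.
  (* Otherwise [s] occurs after [a], and an entry of [rs], which is nonempty like [st], forms a 321
     with [a] and [s]. *)
  have a_s : a = s.
    apply/eqP; move: a_st; rewrite inE => /orP [//|/(pending_min pst) s_a].
    have s_lo : s < lo by apply: (pending_lt pst); rewrite inE eqxx.
    have s_w : s \in w.
      have := M s; rewrite mem_cat !inE eqxx /=; case/or3P => // [/(allP ars)|/eqP]; lia.
    case: rs sz av {Un pm srs M sub_av a_rs last_lo} ars => // r rs _ av /= /andP [lo_r _].
    exfalso; apply: (av321F (x := r) (y := a) (z := s) av) => //; last lia.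
    rewrite catrevE rev_cons cat_rcons -[[:: r; a; s]]cat0s cat_subseq ?sub0seq //=.
    by rewrite !eqxx sub1seq.
  subst a; have [lo_rs|lo_rs] := boolP (lo \in rs).
    have [rs' [def_rs srs' ars']] := sorted_gtn_last srs ars lo_rs.
    apply/orP; right; apply/orP; right; rewrite mem_cat; apply/orP; right.
    apply/mapP; exists (rs', w) => /=; last by rewrite def_rs.
    apply: IH; first exact: pendingS (pending_cons pst).
    split=> //=.
    + by move: sz; rewrite def_rs size_rcons /= => -[].
    + move/seq.permP: pm => pm; apply/seq.permP=> p; have := pm p.
      by rewrite def_rs -cats1 !count_cat /=; lia.
    apply: sub_av; rewrite def_rs catrev_rcons.
    exact: subseq_trans (subseq_catrev_cons _ _ _) (subseq_cons _ _).
  apply/orP; left; apply/mapP; exists (rs, w) => //=.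
  apply: IH.
    by have := pending_rcons pst; rewrite rcons_head => /pending_cons.
  split=> //=.
  + by rewrite sz size_rcons.
  + move/seq.permP: pm => pm; apply/seq.permP=> p; have := pm p.
    by rewrite -cats1 !count_cat /=; lia.
  + exact: last_lo.
  by apply: sub_av; exact: subseq_catrev_cons.
(* With nothing pending, [rs] is empty and [a] is either [lo], a fixed point, or larger, which opens
   a position. *)
case: st pst sz pm M a_st => [|s st] pst sz pm M a_st.
  case: rs sz {srs ars sub_av a_rs last_lo} pm av M Un => // _ pm av M Un.
  have [E|a_neq] := eqVneq a lo.
    subst a; apply/orP; left; apply/mapP; exists ([::], w) => //=; apply: IH => //.
    by split=> //=; [move: pm; rewrite /= perm_cons | apply: av3_subseq av; exact: subseq_cons].
  apply/orP; right; apply/orP; left; apply/mapP; exists ([:: a], w) => //=.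
  apply: IH; first exact: (pending_rcons (st := [::])).
  by split=> //=; rewrite andbT; lia.
(* Otherwise [x], [a] and the pending value [s], which must occur in [w], form a 321. *)
have gt_a x : x \in rs -> x < a.
  move=> xrs; rewrite ltnNge leq_eqVlt; apply/negP => /orP [/eqP E|a_x].
    by rewrite E xrs in a_rs.
  have s_lo : s < lo by apply: (pending_lt pst); rewrite inE eqxx.
  have s_w : s \in w.
    have := M s; rewrite mem_cat !inE eqxx /=; case/or3P => // [/(allP ars)|/eqP]; lia.
  exfalso; apply: (av321F (x := x) (y := a) (z := s) av) => //; last lia.
  rewrite catrevE (@cat_subseq _ [:: x] [:: a; s]) ?sub1seq ?mem_rev //=.
  by rewrite !eqxx sub1seq.
have a_neq : lo < a.
  case: rs sz ars gt_a {pm srs av M Un sub_av a_rs last_lo} => //= r rs _ /andP [lo_r _].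
  by move=> /(_ r); rewrite inE eqxx => /(_ isT); lia.
have sars rs' : sorted gtn rs' -> {subset rs' <= rs} -> sorted gtn (a :: rs').
  move=> srs' sub; rewrite /= path_sortedE ?srs' ?andbT; last exact: rev_trans ltn_trans.
  by apply/allP => x /sub /gt_a.
have [lo_rs|lo_rs] := boolP (lo \in rs).
  have [rs' [def_rs srs' ars']] := sorted_gtn_last srs ars lo_rs.
  apply/orP; right; apply/orP; right; rewrite mem_cat; apply/orP; left.
  apply/mapP; exists (a :: rs', w) => /=; last by rewrite def_rs.
  apply: IH; first exact: pendingS.
  split=> /=.
  + by move: sz; rewrite def_rs size_rcons.
  + move/seq.permP: pm => pm; apply/seq.permP=> p; have := pm p.
    by rewrite def_rs /= -cats1 !count_cat /=; lia.
  + by apply: sars => // x; rewrite def_rs mem_rcons inE orbC => ->.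
  + by rewrite a_neq.
  by apply: sub_av; rewrite def_rs catrev_rcons; exact: subseq_cons.
apply/orP; right; apply/orP; left; apply/mapP; exists (a :: rs, w) => //=.
apply: IH; first exact: (pending_rcons pst).
split=> //=.
+ by rewrite sz size_rcons.
+ move/seq.permP: pm => pm; apply/seq.permP=> p; have := pm p.
  by rewrite -cats1 /= !count_cat /=; lia.
+ exact: sars.
+ by rewrite a_neq last_lo.
Qed.

Lemma uniq_cat_sep (T : eqType) (p : pred T) (s1 s2 : seq T) :
  uniq s1 -> uniq s2 -> {in s1, forall x, ~~ p x} -> {in s2, forall x, p x} ->
  uniq (s1 ++ s2).
Proof.
move=> u1 u2 np1 p2; rewrite cat_uniq u1 u2 andbT /=.
by apply/hasPn => x /p2 px; apply/negP => /np1; rewrite px.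
Qed.

(** The four parts are told apart by whether the first letter of [u.2] exceeds [lo] and whether [lo]
    lies in [u.1]. *)
Lemma states321_uniq m lo st : pending lo st -> uniq (states321 m lo st).
Proof.
elim: m lo st => [|m IH] lo st pst; first by case: st {pst}.
have pst' := pending_rcons pst.
have pst2 : pending lo.+1 (behead (rcons st lo)) by exact: pending_behead.
have head_le : head lo st <= lo.
  by case: st pst {pst' pst2} => //= s st /pending_lt H; rewrite ltnW // H ?inE ?eqxx.
have notin_rs st1 u : pending lo.+1 st1 -> u \in states321 m lo.+1 st1 -> lo \notin u.1.
  by move=> p1 /(states321_sound p1) [_ _ _ /allP ars _]; apply/negP => /ars; rewrite ltnn.
have head_gt s st1 u : pending lo.+1 (s :: st1) -> u \in states321 m lo.+1 (s :: st1) ->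
    exists r rs, u.1 = r :: rs /\ lo < r.
  move=> p1 /(states321_sound p1) [sz _ _ ars _]; case: (u.1) sz ars => //= r rs _ /andP [? _].
  by exists r, rs.
(* Popping loses nothing: [u.1] has the size of a nonempty list, so the default [0] of [head] never
   occurs. *)
have inj_pop s st1 : pending lo.+1 (s :: st1) ->
    {in states321 m lo.+1 (s :: st1) &, forall u v,
      behead u.1 = behead v.1 -> head 0 u.1 :: u.2 = head 0 v.1 :: v.2 -> u = v}.
  move=> p1 [rs w] [rs' w'] /(head_gt _ _ _ p1) [r [rs1 /= [-> _]]].
  move=> /(head_gt _ _ _ p1) [r' [rs1' /= [-> _]]] /= -> [-> ->].
  by [].
rewrite [states321 _ _ _]/=; apply: (uniq_cat_sep (p := fun u : seq nat * seq nat => (lo < head 0 u.2) || (lo \in u.1))).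
- by rewrite map_inj_in_uniq ?IH // => -[? ?] [? ?] _ _ /= [-> ->].
- apply: (uniq_cat_sep (p := fun u : seq nat * seq nat => lo \in u.1)).
  + rewrite map_inj_in_uniq ?IH // => u v.
    by move: pst'; rewrite rcons_head => p1 /(inj_pop _ _ p1) H /H {}H [? ? ?]; apply: H => //; congr cons.
  + case: st pst {pst' pst2 head_le} => // s st pst.
    apply: (uniq_cat_sep (p := fun u : seq nat * seq nat => head 0 u.2 < lo)).
    * rewrite map_inj_in_uniq ?IH ?pendingS // => u v.
      move=> /(inj_pop _ _ (pendingS pst)) H /H {}H [].
      move=> /(congr1 rev); rewrite !rev_rcons => -[] /(can_inj revK) e1 e2 e3.
      by apply: H => //; congr cons.
    * rewrite map_inj_in_uniq ?IH ?pendingS //; first exact: pending_cons pst.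
      by move=> [? ?] [? ?] _ _ /= [/(congr1 rev)]; rewrite !rev_rcons => -[] /(can_inj revK) -> ->.
    * move=> _ /mapP [u /(head_gt _ _ _ (pendingS pst)) [r [rs [-> lo_r]]] ->] /=; lia.
    * by move=> _ /mapP [u _ ->] /=; apply: (pending_lt pst); rewrite inE eqxx.
  + move=> _ /mapP [u uin ->] /=; have := notin_rs _ _ pst' uin.
    by apply: contra; exact: mem_behead.
  + case: st {pst pst' pst2 head_le} => // s st u; rewrite mem_cat => /orP [] /mapP [v _ ->];
    by rewrite /= mem_rcons inE eqxx.
- move=> _ /mapP [u uin ->] /=; rewrite negb_or (notin_rs _ _ pst2 uin) andbT; lia.
move=> u; rewrite mem_cat => /orP [/mapP [v]|].
  by move: pst'; rewrite rcons_head => p1 /(head_gt _ _ _ p1) [r [rs [-> lo_r]]] -> /=; rewrite lo_r.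
case: st {pst pst' pst2 head_le} => // s st; rewrite mem_cat => /orP [] /mapP [v _ ->];
by rewrite /= mem_rcons inE eqxx orbT.
Qed.

(** * Statistics of words, letter by letter *)

Fixpoint seq_exc (lo : nat) (w : seq nat) : nat :=
  if w is a :: w' then (lo < a) + seq_exc lo.+1 w' else 0.

Fixpoint seq_inv (w : seq nat) : nat :=
  if w is a :: w' then count (gtn a) w' + seq_inv w' else 0.

(* [pre] are the values at the positions below [lo]. *)
Fixpoint seq_cda (lo : nat) (pre w : seq nat) : nat :=
  if w is a :: w' then ((lo < a) && (lo \in pre)) + seq_cda lo.+1 (a :: pre) w' else 0.

Lemma eq_seq_cda lo p1 p2 w :
  (forall x, lo <= x -> (x \in p1) = (x \in p2)) -> seq_cda lo p1 w = seq_cda lo p2 w.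
Proof.
elim: w lo p1 p2 => //= a w IH lo p1 p2 eq_p; rewrite eq_p //; congr (_ + _).
by apply: IH => x lo_x; rewrite !inE eq_p // ltnW.
Qed.

(** The smallest letter is inverted with exactly the letters before it. *)
Lemma seq_inv_insert_min s u v : {in u ++ v, forall x, s < x} ->
  seq_inv (u ++ s :: v) = size u + seq_inv (u ++ v).
Proof.
elim: u => [|a u IH] smin /=.
  rewrite (_ : count _ v = 0) //; apply/eqP; rewrite -leqn0 leqNgt -has_count.
  by apply/hasPn => x /smin; rewrite /= -leqNgt => /ltnW.
rewrite IH => [|x xin]; last by apply: smin; rewrite inE xin orbT.
have s_a : s < a by apply: smin; rewrite inE eqxx.
by rewrite !count_cat /= s_a; lia.
Qed.

(** These letters give the inversions gained when [lo] is put in front of the word. *)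
Lemma state321_count m lo st u : pending lo st -> state321 m lo st u ->
  count (gtn lo) (catrev u.1 u.2) = size st.
Proof.
move=> pst [_ /seq.permP pm _ _ _]; rewrite catrevE count_cat count_rev -count_cat pm count_cat.
case/andP: pst => _; rewrite all_count => /eqP ->.
rewrite (_ : count _ (iota _ _) = 0) ?addn0 //; apply/eqP; rewrite -leqn0 leqNgt -has_count.
by apply/hasPn => x; rewrite mem_iota /= => /andP [? _]; rewrite -leqNgt.
Qed.

Local Open Scope ring_scope.

Section Weight321.
Variable R : comNzRingType.
Variables t q c : R.

(** The list [u.1] suffices as prefix for [seq_cda]: values below [lo] are never looked up again. *)
Definition weight321 lo (u : seq nat * seq nat) : R :=
  t ^+ seq_exc lo u.2 * q ^+ seq_inv (catrev u.1 u.2) * c ^+ seq_cda lo u.1 u.2.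

Lemma state321_gt_min m lo s st u :
  pending lo.+1 (s :: st) -> state321 m lo.+1 st u -> {in u.1 ++ u.2, forall x, s < x}%N.
Proof.
move=> pst St x; rewrite (state321_mem St) => /orP [|/andP [lo_x _]].
  exact: (pending_min pst).
by apply: leq_trans lo_x; apply: (pending_lt pst); rewrite inE eqxx.
Qed.

Lemma weight321_level m lo s st u :
  pending lo.+1 (s :: st) -> state321 m lo.+1 st u ->
  weight321 lo (u.1, s :: u.2) = q ^+ size st * weight321 lo.+1 u.
Proof.
move=> pst St; have smin := state321_gt_min pst St; have [sz _ _ _ _] := St.
have s_lo : (s <= lo)%N by rewrite -ltnS; apply: (pending_lt pst); rewrite inE eqxx.
rewrite /weight321 /= ltnNge s_lo /= !add0n !catrevE.
rewrite seq_inv_insert_min; last first.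
  by move=> x; rewrite mem_cat mem_rev -mem_cat; exact: smin.
rewrite size_rev sz exprD (@eq_seq_cda _ (s :: u.1) u.1).
  by ring.
by move=> x lo_x; rewrite inE (_ : x == s = false) //; apply/eqP; lia.
Qed.

Lemma weight321_up m lo r rs w st :
  state321 m lo.+1 st (r :: rs, w) ->
  weight321 lo (rs, r :: w) = t * weight321 lo.+1 (r :: rs, w).
Proof.
case=> _ _ _ /= /andP [lo_r /allP ars] _.
have lo_rs : lo \notin rs by apply/negP => /ars; rewrite ltnn.
by rewrite /weight321 /= lo_r (negPf lo_rs) add0n exprS; ring.
Qed.

(** Position [lo] becomes an excedance whose index is already a value further left, whence [c * t];
    the letter [lo] in front is inverted with the [size st] smaller ones. *)
Lemma weight321_level_both m lo r rs w st :
  pending lo.+1 st -> state321 m lo.+1 st (r :: rs, w) -> lo \notin st ->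
  weight321 lo (rcons rs lo, r :: w) =
  c * t * q ^+ size st * weight321 lo.+1 (r :: rs, w).
Proof.
move=> pst St lo_st; have [_ _ _ /= /andP [lo_r _] _] := St.
have /= := state321_count pst St.
rewrite /weight321 /= lo_r mem_rcons inE eqxx /= catrev_rcons /=.
rewrite (@eq_seq_cda _ (r :: rcons rs lo) (r :: rs)); last first.
  by move=> x lo_x; rewrite !inE mem_rcons inE (_ : x == lo = false) //; apply/eqP; lia.
have lo_cat : lo \notin catrev rs (r :: w).
  have := state321_mem St lo; rewrite (negPf lo_st) ltnn /= => /negbT.
  by rewrite catrevE !(inE, mem_cat, mem_rev) orbCA.
have -> : count (gtn lo.+1) (catrev rs (r :: w)) = count (gtn lo) (catrev rs (r :: w)).
  apply: eq_in_count => x xin /=; rewrite ltnS leq_eqVlt orbC; case: eqP xin lo_cat => [-> ->|_ _ _] //.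
  by rewrite orbF.
by move=> ->; rewrite !exprD !expr1; ring.
Qed.

(** The smallest letter [s] is inverted with [lo] and the [size st] values of [u.1]; then [lo] is
    inverted with the [size st] remaining smaller letters. *)
Lemma weight321_down m lo s st u :
  pending lo (s :: st) -> state321 m lo.+1 st u ->
  weight321 lo (rcons u.1 lo, s :: u.2) =
  q ^+ ((size st).+1 + size st) * weight321 lo.+1 u.
Proof.
move=> pst St; have [sz _ _ /allP ars _] := St.
have pst1 : pending lo st := pending_cons pst.
have s_lo : (s < lo)%N by apply: (pending_lt pst); rewrite inE eqxx.
have lo_st : lo \notin st by apply/negP => /(pending_lt pst1); rewrite ltnn.
have smin := state321_gt_min (pendingS pst) St.
rewrite /weight321 /= ltnNge (ltnW s_lo) /= !add0n.
rewrite (@eq_seq_cda _ (s :: rcons u.1 lo) u.1); last first.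
  move=> x lo_x; rewrite !inE mem_rcons inE.
  by rewrite !gtn_eqF // (ltn_trans s_lo).
rewrite catrevE seq_inv_insert_min; last first.
  move=> x; rewrite mem_cat mem_rev mem_rcons inE -orbA => /orP [/eqP ->//|].
  by rewrite -mem_cat; exact: smin.
rewrite -catrevE catrev_rcons size_rev size_rcons sz /=.
have -> : count (gtn lo) (catrev u.1 u.2) = size st.
  rewrite -(state321_count (pendingS pst1) St).
  apply: eq_in_count => x xin /=; rewrite ltnS [RHS]leq_eqVlt; case: eqP xin => [->|] //=.
  have := state321_mem St lo; rewrite (negPf lo_st) ltnn /= => /negbT.
  by rewrite catrevE !mem_cat mem_rev => /negPf ->.
by rewrite !exprD; ring.
Qed.

(* A state at height h starts with h entries exceeding h later ones; the weight
   q^(h(h+1)/2) normalises this so that a step ending at height h weighs q^h. *)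
Lemma sum_states321 m lo st : pending lo st ->
  \sum_(u <- states321 m lo st) weight321 lo u =
  q ^+ 'C((size st).+1, 2) *
  motz (fun h => t * q ^+ h.+1)
       (fun h => q ^+ h + (if h is h'.+1 then c * t * q ^+ h else 0))
       (fun h => q ^+ h) m (size st).
Proof.
elim: m lo st => [|m IH] lo st pst.
  case: st {pst} => [|s st] /=; rewrite ?big_nil ?big_seq1 /weight321 //=; ring.
have pst' := pending_rcons pst.
rewrite [LHS]/= !big_cat !big_map /=.
rewrite [X in X + _](_ : _ = q ^+ size st * (q ^+ 'C((size st).+1, 2) *
    motz (fun h => t * q ^+ h.+1)
       (fun h => q ^+ h + (if h is h'.+1 then c * t * q ^+ h else 0))
       (fun h => q ^+ h) m (size st))); last first.
  have sz : size (behead (rcons st lo)) = size st by rewrite size_behead size_rcons.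
  have pst2 : pending lo.+1 (behead (rcons st lo)) by exact: pending_behead.
  rewrite -[X in _ = _ * (_ ^+ 'C(X.+1, _) * _ _ X)]sz -(IH _ _ pst2) mulr_sumr.
  apply: eq_big_seq => u uin; rewrite -[in RHS]sz.
  rewrite rcons_head in pst'.
  exact: weight321_level pst' (states321_sound pst2 uin).
rewrite [X in _ + (X + _)](_ : _ = t * (q ^+ 'C((size st).+2, 2) *
    motz (fun h => t * q ^+ h.+1)
       (fun h => q ^+ h + (if h is h'.+1 then c * t * q ^+ h else 0))
       (fun h => q ^+ h) m (size st).+1)); last first.
  have sz : size (rcons st lo) = (size st).+1 by rewrite size_rcons.
  rewrite -sz -(IH _ _ pst') mulr_sumr.
  apply: eq_big_seq => -[rs w] uin; have St := states321_sound pst' uin.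
  case: rs St {uin} => [[] /=|r rs St]; first by rewrite size_rcons.
  exact: weight321_up St.
(* The difference of the two normalising exponents is the power of [q] carried by a rise. *)
rewrite [in 'C((size st).+2, 2)]binS bin1 exprD.
case: st pst {pst'} => [|s st] pst.
  by rewrite big_nil /= exprS; ring.
have pst1 := pending_cons pst.
rewrite big_cat !big_map /=.
have lo_st : lo \notin s :: st by apply/negP => /(pending_lt pst); rewrite ltnn.
rewrite [X in _ + (_ + (X + _))](_ : _ = c * t * q ^+ (size st).+1 *
    \sum_(u <- states321 m lo.+1 (s :: st)) weight321 lo.+1 u); last first.
  rewrite mulr_sumr; apply: eq_big_seq => -[rs w] uin.
  have St := states321_sound (pendingS pst) uin.
  case: rs St {uin} => [[] //|r rs St].
  exact: weight321_level_both (pendingS pst) St lo_st.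
rewrite [X in _ + (_ + (_ + X))](_ : _ = q ^+ ((size st).+1 + size st) *
    \sum_(u <- states321 m lo.+1 st) weight321 lo.+1 u); last first.
  rewrite mulr_sumr; apply: eq_big_seq => u uin.
  exact: weight321_down pst (states321_sound (pendingS pst1) uin).
rewrite (IH _ _ (pendingS pst)) (IH _ _ (pendingS pst1)) /=.
(* For a fall the normalisation absorbs [q ^+ (size st).+1] and leaves [q ^+ size st]. *)
have -> : 'C((size st).+2, 2) = ('C((size st).+1, 2) + (size st).+1)%N by rewrite binS bin1.
by rewrite !exprD !exprS; ring.
Qed.

End Weight321.

(** * Permutations avoiding 231 without double descents *)

Local Open Scope nat_scope.

Definition is231 x y z := (z < x) && (x < y).

Lemma av231F w x y z : av3 is231 w -> subseq [:: x; y; z] w -> z < x -> x < y -> False.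
Proof. by move=> av /av /negP H zx xy; apply: H; apply/andP. Qed.

(** The default [a] of [head] makes the last letter contribute nothing, here and in [seq_drop]. *)
Fixpoint seq_des (w : seq nat) : nat :=
  if w is a :: w' then (head a w' < a) + seq_des w' else 0.

Fixpoint seq_drop (w : seq nat) : nat :=
  if w is a :: w' then (a - head a w') + seq_drop w' else 0.

Fixpoint seq_dd (w : seq nat) : nat :=
  if w is a :: w' then
    (if w' is b :: c :: _ then (c < b) && (b < a) else false) + seq_dd w'
  else 0.

(* A state describes the values [lo, ...] of a 231-avoiding word without double
   descents: [u.1] lists (in increasing order) the pending descent tops, whose
   bottoms are below [lo] and not displayed, and [u.2] is the end of the word. *)
Fixpoint states231 (m lo h : nat) : seq (seq nat * seq nat) :=
  if m is m'.+1 then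
    [seq (u.1, lo :: u.2) | u <- states231 m' lo.+1 h]
    ++ ([seq (behead u.1, head 0 u.1 :: lo :: u.2) | u <- states231 m' lo.+1 h.+1]
    ++ (if h is h'.+1 then [seq (lo :: u.1, u.2) | u <- states231 m' lo.+1 h'] else [::]))
  else if h is 0 then [:: ([::], [::])] else [::].

(** The word [catrev u.1 u.2] is the restriction of the whole word to the values from [lo] on. *)
Definition state231 (m lo h : nat) (u : seq nat * seq nat) : Prop :=
  [/\ size u.1 = h, perm_eq (u.1 ++ u.2) (iota lo m), sorted ltn u.1,
      av3 is231 (catrev u.1 u.2) & seq_dd u.2 = 0].

Lemma state231_mem m lo h u : state231 m lo h u ->
  forall x, (x \in u.1 ++ u.2) = (lo <= x < lo + m).
Proof. by case=> _ /perm_mem H _ _ _ x; rewrite H mem_iota. Qed.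

(** The smallest letter can only be the last one of a 231, but the letters before it decrease. *)
Lemma av231_insert_min s xs w :
  sorted ltn xs -> {in xs ++ w, forall x, s < x} ->
  av3 is231 (catrev xs w) -> av3 is231 (catrev xs (s :: w)).
Proof.
rewrite !catrevE => sxs smin av x y z /subseq3_insert [].
- exact: av.
- case=> -> /sub2_mem [_ zw]; have := smin z; rewrite mem_cat zw orbT => /(_ isT).
  by rewrite /is231; lia.
- case=> -> xxs _; have := smin x; rewrite mem_cat -mem_rev xxs => /(_ isT).
  by rewrite /is231; lia.
- case=> -> sub; have : sorted gtn (rev xs) by rewrite rev_sorted.
  by move=> /sub2_gtn /(_ sub); rewrite /is231; lia.
Qed.

Lemma seq_dd_cons_min a w : {in w, forall x, a < x} -> seq_dd (a :: w) = seq_dd w.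
Proof.
case: w => [|b [|c w]] //= amin; have := amin b; rewrite inE eqxx => /(_ isT).
by case: ltnP => //=; lia.
Qed.

(** After [a] the word goes up or ends, so no double descent starts at [b] or at [a]. *)
Lemma seq_dd_cons2_min b a w :
  {in w, forall x, a < x} -> seq_dd (b :: a :: w) = seq_dd w.
Proof.
move=> amin; rewrite -[RHS](seq_dd_cons_min amin).
case: w amin => //= c w /(_ c); rewrite inE eqxx => /(_ isT).
by case: (ltnP c a) => //=; lia.
Qed.

(** All three extensions insert [lo] right after the pending tops; they differ only in where [u.1]
    is cut from [u.2]. *)
Lemma states231_sound m lo h u : u \in states231 m lo h -> state231 m lo h u.
Proof.
elim: m lo h u => [|m IH] lo h u.
  by case: h => //=; rewrite inE => /eqP ->; split.
have lo_min xs w k : state231 m lo.+1 k (xs, w) -> {in xs ++ w, forall x, lo < x}.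
  by move=> St x; rewrite (state231_mem St) => /andP [].
rewrite /= !mem_cat => /or3P [/mapP [[xs w]] | /mapP [[xs w]] | ].
- move/IH=> St ->; have lmin := lo_min _ _ _ St.
  case: St => /= sz /seq.permP pm sxs av dd; split=> //=.
  + by apply/seq.permP=> p; have := pm p; rewrite /= !count_cat /=; lia.
  + exact: av231_insert_min.
  + have wmin : {in w, forall x, lo < x} by move=> x xw; apply: lmin; rewrite mem_cat xw orbT.
    exact: etrans (seq_dd_cons_min wmin) dd.
- move/IH=> St ->; have lmin := lo_min _ _ _ St.
  case: St lmin => /=; case: xs => //= x xs [sz] /seq.permP pm sxs av dd lmin; split=> //=.
  + by apply/seq.permP=> p; have := pm p; rewrite /= !count_cat /=; lia.
  + exact: path_sorted sxs.
  + exact: (av231_insert_min (xs := x :: xs)).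
  have wmin : {in w, forall x, lo < x}.
    by move=> y yw; apply: lmin; rewrite inE mem_cat yw !orbT.
  exact: etrans (seq_dd_cons2_min _ wmin) dd.
case: h => // h /mapP [[xs w]] /IH St ->; have lmin := lo_min _ _ _ St.
case: St => /= sz /seq.permP pm sxs av dd; split=> //=.
- by rewrite sz.
- by apply/seq.permP=> p; have := pm p; rewrite /= !count_cat /=; lia.
- rewrite path_sortedE ?sxs ?andbT; last exact: ltn_trans.
  by apply/allP => x xxs; apply: lmin; rewrite mem_cat xxs.
- exact: av231_insert_min.
Qed.

(** Either [lo] is the first entry of [xs], or it is the first or second letter of [w]. *)
Lemma states231_complete m lo h u : state231 m lo h u -> u \in states231 m lo h.
Proof.
elim: m lo h u => [|m IH] lo h [xs w] St; have M := state231_mem St; case: (St) => /= sz pm sxs av dd.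
  by move/perm_size: pm sz; case: xs w {M St sxs av dd} => [|? ?] [|? ?] //= _ <-.
have Un : uniq (xs ++ w) by rewrite (perm_uniq pm) (iota_uniq _ m.+1).
have ge_lo x : x \in xs ++ w -> lo <= x by rewrite M => /andP [].
have lo_in : lo \in xs ++ w by rewrite M; lia.
have sub_av v : subseq v (catrev xs w) -> av3 is231 v by move/av3_subseq; apply.
rewrite !mem_cat; have [lo_xs|lo_xs] := boolP (lo \in xs).
  case: xs sz pm sxs av M Un ge_lo lo_xs sub_av {lo_in St} => // x xs sz pm sxs av M Un ge_lo lo_xs sub_av.
  have lo_x : x = lo.
    apply/eqP; have := ge_lo x; rewrite inE eqxx => /(_ isT) le_x.
    move: lo_xs sxs; rewrite inE eq_sym /= path_sortedE; last exact: ltn_trans.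
    case: eqP => // _ /= lo_xs /andP [/allP /(_ _ lo_xs) /= x_lo _].
    by rewrite ltnNge le_x in x_lo.
  subst x; apply/orP; right; apply/orP; right; case: h sz => // h [sz].
  apply/mapP; exists (xs, w) => //; apply: IH; split=> //=.
  + by move: pm; rewrite /= perm_cons.
  + exact: path_sorted sxs.
  + exact: (av3_subseq (subseq_catrev_cons _ _ _) av).
have {lo_in} lo_w : lo \in w by move: lo_in; rewrite mem_cat (negPf lo_xs).
case: w pm av dd M Un ge_lo lo_w sub_av {St} => // b w pm av dd M Un ge_lo lo_w sub_av.
have [E|neq_b] := eqVneq b lo.
  subst b; apply/orP; left; apply/mapP; exists (xs, w) => //; apply: IH; split=> //=.
  + by move/seq.permP: pm => pm; apply/seq.permP => p; have := pm p; rewrite /= !count_cat /=; lia.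
  + exact: (av3_subseq (subseq_catrev_cons _ _ _) av).
  + by case: w dd {pm av M Un ge_lo lo_w sub_av} => //= c w; lia.
apply/orP; right; apply/orP; left.
have {}lo_w : lo \in w by move: lo_w; rewrite inE eq_sym (negPf neq_b).
have lo_b : lo < b.
  by rewrite ltn_neqAle eq_sym neq_b ge_lo // mem_cat inE eqxx orbT.
have sub_end v : subseq v (b :: w) -> av3 is231 v.
  by move=> sub; apply: sub_av; rewrite catrevE -[v]cat0s cat_subseq ?sub0seq.
case: w pm av dd M Un ge_lo lo_w sub_av sub_end => // c w pm av dd M Un ge_lo lo_w sub_av sub_end.
(* Otherwise an ascent stands before [lo] and gives a 231: [b], [c] if [b < c], else [c] and the
   next letter [d], since double descents are excluded. *)
have c_lo : c = lo.
  apply/eqP; move: lo_w; rewrite inE eq_sym; case: eqP => //= neq_c lo_w.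
  have lo_c : lo < c.
    by rewrite ltn_neqAle eq_sym ge_lo ?andbT; [apply/eqP | rewrite mem_cat !inE eqxx !orbT].
  have [bc|cb|E] := ltngtP b c.
  + exfalso; apply: (av231F (x := b) (y := c) (z := lo) (sub_end _ (subseq_refl _))) => //.
    by rewrite /= !eqxx sub1seq.
  + case: w lo_w dd Un sub_end {pm av M ge_lo sub_av} => // d w lo_w dd Un sub_end; rewrite /= in dd.
    have neq_cd : c != d.
      by move: Un; rewrite cat_uniq /= !inE => /and5P [_ _ _ /norP []].
    have cd : c < d by lia.
    exfalso; apply: (av231F (x := c) (y := d) (z := lo) (sub_end _ (subseq_refl _))) => //.
    rewrite /= (ltn_eqF cb) !eqxx sub1seq.
    by move: lo_w; rewrite inE; case: eqP => // E; lia.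
  + by move: Un; rewrite cat_uniq /= E inE eqxx /= !andbF.
subst c; apply/mapP; exists (b :: xs, w) => //; apply: IH; split=> /=.
- by rewrite sz.
- by move/seq.permP: pm => pm; apply/seq.permP => p; have := pm p; rewrite /= !count_cat /=; lia.
(* A pending top [x] below [b] would form a 231 with [b] and [lo]. *)
- rewrite path_sortedE ?sxs ?andbT; last exact: ltn_trans.
  apply/allP => x xxs; rewrite /= ltn_neqAle leqNgt.
  have neq_bx : b != x.
    apply/eqP => E; move: Un; rewrite cat_uniq => /and3P [_ /norP [/negP H _] _].
    by apply: H; rewrite E.
  rewrite neq_bx; apply/negP => xb.
  apply: (av231F (x := x) (y := b) (z := lo) av) => //.
    by rewrite catrevE (@cat_subseq _ [:: x] [:: b; lo]) ?sub1seq ?mem_rev //= !eqxx sub0seq.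
  rewrite ltn_neqAle ge_lo ?mem_cat ?xxs // andbT.
  by apply/eqP => E; rewrite E xxs in lo_xs.
- by apply: sub_av; rewrite !catrevE cat_subseq ?subseq_refl //= eqxx; exact: subseq_cons.
- by case: w dd {pm av M Un ge_lo lo_w sub_av sub_end} => [|d [|e w]] //= dd; lia.
Qed.

Lemma state231_gt_min m lo h u : state231 m lo.+1 h u -> {in u.1 ++ u.2, forall x, lo < x}.
Proof. by move=> St x; rewrite (state231_mem St) => /andP []. Qed.

Lemma states231_uniq m lo h : uniq (states231 m lo h).
Proof.
elim: m lo h => [|m IH] lo h; first by case: h.
have gt_lo k u : u \in states231 m lo.+1 k -> {in u.1 ++ u.2, forall x, lo < x}.
  by move=> /states231_sound; exact: state231_gt_min.
have sz k u : u \in states231 m lo.+1 k -> size u.1 = k.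
  by move=> /states231_sound [].
rewrite [states231 _ _ _]/=.
(* The default [lo.+1] makes an empty [u.2] count as not starting with [lo]. *)
apply: (uniq_cat_sep (p := fun u : seq nat * seq nat => head lo.+1 u.2 != lo)).
- by rewrite map_inj_uniq ?IH // => -[? ?] [? ?] /= [-> ->].
- apply: (uniq_cat_sep (p := fun u : seq nat * seq nat => lo \in u.1)).
  + rewrite map_inj_in_uniq ?IH // => -[xs w] [xs' w'] /sz + /sz.
    by case: xs => //= x xs _; case: xs' => //= x' xs' _ [-> -> ->].
  + by case: h => // h; rewrite map_inj_uniq ?IH // => -[? ?] [? ?] /= [-> ->].
  + move=> _ /mapP [u /gt_lo gt_u ->] /=; apply/negP => /mem_behead lo_u.
    by have := gt_u lo; rewrite mem_cat lo_u ltnn => /(_ isT).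
  + by case: h => // h _ /mapP [u _ ->]; rewrite inE eqxx.
- by move=> _ /mapP [u _ ->] /=; rewrite eqxx.
move=> u; rewrite mem_cat => /orP [/mapP [[xs w] uin ->] /=|].
  case: xs uin => [/sz //|x xs /gt_lo /(_ x)]; rewrite inE eqxx => /(_ isT) /=.
  by rewrite neq_ltn orbC => ->.
case: h => // h /mapP [[xs [|b w]] /gt_lo gt_u ->] /=; first by rewrite neq_ltn ltnSn orbT.
by rewrite neq_ltn orbC gt_u // mem_cat inE eqxx orbT.
Qed.

Local Open Scope ring_scope.

Section Weight231.
Variable R : comNzRingType.
Variables t q : R.

(** A pending top contributes its drop down to [lo] only; the rest is added as [lo] decreases to its
    bottom. *)
Definition weight231 lo (u : seq nat * seq nat) : R :=
  t ^+ seq_des u.2 * q ^+ (\sum_(x <- u.1) (x - lo) + seq_drop u.2).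

Lemma sum_subnS lo (xs : seq nat) : {in xs, forall x, lo < x}%N ->
  (\sum_(x <- xs) (x - lo) = \sum_(x <- xs) (x - lo.+1) + size xs)%N.
Proof.
move=> gt_xs; rewrite -sum1_size -big_split; apply: eq_big_seq => x /gt_xs /=; lia.
Qed.

Lemma head_min (lo : nat) w : {in w, forall x, lo < x}%N -> (lo <= head lo w)%N.
Proof. by case: w => //= x w H; rewrite ltnW // H // inE eqxx. Qed.

(** Passing from [lo.+1] to [lo] lengthens the drop of every pending top by one, which is the power
    of [q] of the step; closing a top by its bottom gives the [t]. *)
Lemma sum_states231 m lo h :
  \sum_(u <- states231 m lo h) weight231 lo u =
  motz (fun h => t * q ^+ h.+1) (fun h => q ^+ h) (fun h => q ^+ h) m h.
Proof.
elim: m lo h => [|m IH] lo h.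
  by case: h => [|h] /=; rewrite ?big_nil ?big_seq1 /weight231 //= big_nil !mulr1.
have gt_lo k u : u \in states231 m lo.+1 k ->
    [/\ size u.1 = k, {in u.1, forall x, lo < x}%N & {in u.2, forall x, lo < x}%N].
  move=> /states231_sound St; have := state231_gt_min St; case: St => sz _ _ _ _ gt_u.
  by split=> // x xin; apply: gt_u; rewrite mem_cat xin ?orbT.
rewrite [LHS]/= !big_cat !big_map /= -!(IH lo.+1) addrA !mulr_sumr.
congr (_ + _ + _).
- apply: eq_big_seq => -[xs w] /gt_lo [/= sz gt_xs gt_w].
  rewrite /weight231 /= sum_subnS // sz ltnNge head_min //= add0n.
  by rewrite (eqnP (head_min gt_w)) add0n !exprD; ring.
- apply: eq_big_seq => -[xs w] /gt_lo [/= sz gt_xs gt_w].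
  case: xs sz gt_xs => //= x xs [sz] gt_xs.
  have gt_xs' : {in xs, forall x, lo < x}%N by move=> y yin; apply: gt_xs; rewrite inE yin orbT.
  have lo_x : (lo < x)%N by apply: gt_xs; rewrite inE eqxx.
  rewrite /weight231 /= big_cons sum_subnS // sz lo_x ltnNge head_min //=.
  rewrite (eqnP (head_min gt_w)) !add0n !exprD !exprS.
  rewrite (_ : (x - lo)%N = (x - lo.+1).+1); last lia.
  by rewrite exprS; ring.
- case: h => [|h]; first by rewrite big_nil.
  rewrite big_map -(IH lo.+1) mulr_sumr.
  apply: eq_big_seq => -[xs w] /gt_lo [/= sz gt_xs gt_w].
  by rewrite /weight231 /= big_cons subnn add0n sum_subnS // sz !exprD; ring.
Qed.

End Weight231.

(** * Statistics read on the word of a permutation *)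

Local Open Scope nat_scope.

Lemma size_word m (s : 'S_m) : size (word s) = m.
Proof. by rewrite size_map size_enum_ord. Qed.

Lemma wvE m (s : 'S_m) (i : 'I_m) : wv s i = s i.
Proof.
by rewrite /wv /word (nth_map i) ?size_enum_ord // nth_ord_enum.
Qed.

Lemma wv_lt m (s : 'S_m) i : i < m -> wv s i < m.
Proof. by move=> lt_im; rewrite (wvE s (Ordinal lt_im)). Qed.

Lemma uniq_word m (s : 'S_m) : uniq (word s).
Proof. by rewrite map_inj_uniq ?enum_uniq // => i j /val_inj /perm_inj. Qed.

Lemma perm_word m (s : 'S_m) : perm_eq (word s) (iota 0 m).
Proof.
apply: uniq_perm; rewrite ?uniq_word ?iota_uniq // => x; rewrite mem_iota /=.
apply/mapP/idP => [[i _ ->]|lt_xm]; first exact: ltn_ord.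
by exists (s^-1 (Ordinal lt_xm))%g; rewrite ?mem_enum // permKV.
Qed.

Lemma word_inj m : injective (@word m).
Proof.
move=> s s' eq_w; apply/permP => i; apply: val_inj.
by rewrite /= -!wvE /wv eq_w.
Qed.

Lemma word_surj m (w : seq nat) : perm_eq w (iota 0 m) -> exists s : 'S_m, word s = w.
Proof.
move=> pw; have sz : size w = m by rewrite (perm_size pw) size_iota.
have lt_w (i : 'I_m) : nth 0 w i < m.
  have : nth 0 w i \in w by rewrite mem_nth // sz.
  by rewrite (perm_mem pw) mem_iota.
have f_inj : injective (fun i => Ordinal (lt_w i)).
  move=> i j [/eqP]; rewrite nth_uniq ?sz //; first by move/eqP/val_inj.
  by rewrite (perm_uniq pw) iota_uniq.
exists (perm f_inj); apply: (@eq_from_nth _ 0); first by rewrite size_word.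
move=> i; rewrite size_word => lt_im.
by have := wvE (perm f_inj) (Ordinal lt_im); rewrite permE.
Qed.

(** This carries sums over permutations to the explicit lists of words built above. *)
Lemma sum_word (R : nmodType) m (A : pred 'S_m) (L : seq (seq nat)) (F : seq nat -> R) :
  uniq L -> (forall w, w \in L -> perm_eq w (iota 0 m)) ->
  (forall s, A s = (word s \in L)) ->
  (\sum_(s | A s) F (word s) = \sum_(w <- L) F w)%R.
Proof.
move=> uL pL AL; transitivity (\sum_(s in A) F (word s))%R; first exact: eq_bigl.
rewrite -big_enum -(big_map (@word m) xpredT F) /=.
apply: perm_big; apply: uniq_perm => //.
  by rewrite map_inj_uniq ?enum_uniq //; exact: word_inj.
move=> w; apply/mapP/idP => [[s]|wL].
  by rewrite mem_enum unfold_in AL => wL ->.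
have [s def_w] := word_surj (pL w wL).
by exists s => //; rewrite mem_enum unfold_in AL def_w.
Qed.

Lemma seq_invE w : seq_inv w =
  \sum_(i < size w) \sum_(j < size w) ((i < j) && (nth 0 w j < nth 0 w i)).
Proof.
elim: w => [|a w IH] /=; first by rewrite big_ord0.
rewrite big_ord_recl big_ord_recl /= add0n; congr (_ + _).
  by rewrite -sum1_count (big_nth 0) big_mkord big_mkcond.
by rewrite IH; apply: eq_bigr => i _; rewrite big_ord_recl.
Qed.

Lemma seq_excE lo w : seq_exc lo w = \sum_(i < size w) (lo + i < nth 0 w i).
Proof.
elim: w lo => [|a w IH] lo /=; first by rewrite big_ord0.
rewrite big_ord_recl /= addn0 IH; congr (_ + _).
by apply: eq_bigr => i _; rewrite /= addSnnS.
Qed.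

Lemma seq_cdaE lo pre w : seq_cda lo pre w =
  \sum_(i < size w) ((lo + i < nth 0 w i) && (lo + i \in pre ++ take i w)).
Proof.
elim: w lo pre => [|a w IH] lo pre /=; first by rewrite big_ord0.
rewrite big_ord_recl /= addn0 cats0 IH; congr (_ + _).
apply: eq_bigr => i _; rewrite /= addSnnS.
by rewrite !(mem_cat, inE) orbCA.
Qed.

Lemma seq_desE w : seq_des w = \sum_(0 <= i < (size w).-1) (nth 0 w i.+1 < nth 0 w i).
Proof.
elim: w => [|a [|b w] IH]; [by rewrite big_geq | by rewrite big_geq //= ltnn |].
by rewrite big_nat_recl // -[X in _ + X]IH.
Qed.

Lemma seq_dropE w : seq_drop w = \sum_(0 <= i < (size w).-1) (nth 0 w i - nth 0 w i.+1).
Proof.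
elim: w => [|a [|b w] IH]; [by rewrite big_geq | by rewrite big_geq //= subnn |].
by rewrite big_nat_recl // -[X in _ + X]IH.
Qed.

Lemma seq_ddE w : seq_dd w = \sum_(0 <= i < (size w).-2)
  ((nth 0 w i.+2 < nth 0 w i.+1) && (nth 0 w i.+1 < nth 0 w i)).
Proof.
elim: w => [|a [|b [|c w]] IH]; [by rewrite big_geq.. |].
by rewrite big_nat_recl // -[X in _ + X]IH.
Qed.

Lemma inv_word m (s : 'S_m) : Defs.inv s = seq_inv (word s).
Proof.
rewrite seq_invE size_word; apply: eq_bigr => i _; apply: eq_bigr => j _.
by rewrite -/(wv s i) -/(wv s j) !wvE.
Qed.

Lemma exc_word m (s : 'S_m) : exc s = seq_exc 0 (word s).
Proof.
rewrite seq_excE size_word /exc -sum1dep_card big_mkcond.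
by apply: eq_bigr => i _; rewrite -/(wv s i) wvE add0n; case: ltnP.
Qed.

(** That the preimage of [x] is below [x] means that [x] occurs among the first [x] letters. *)
Lemma cda_word m (s : 'S_m) : cda s = seq_cda 0 [::] (word s).
Proof.
rewrite seq_cdaE size_word /cda -sum1dep_card big_mkcond.
apply: eq_bigr => i _; rewrite -/(wv s i) wvE add0n cat0s andbC.
have i_in : (i : nat) \in word s by rewrite (perm_mem (perm_word s)) mem_iota /=.
rewrite in_take //.
have -> : index (i : nat) (word s) = (s^-1)%g i.
  have {1}-> : (i : nat) = nth 0 (word s) (s^-1 i)%g by rewrite -/(wv _ _) wvE permKV.
  by rewrite index_uniq ?uniq_word ?size_word.
by case: (_ && _).
Qed.

Lemma des_word m (s : 'S_m) : des s = seq_des (word s).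
Proof. by rewrite seq_desE size_word. Qed.

Definition drops m (s : 'S_m) := \sum_(0 <= i < m.-1) (wv s i - wv s i.+1).

Lemma drops_word m (s : 'S_m) : drops s = seq_drop (word s).
Proof. by rewrite seq_dropE size_word. Qed.

Lemma nth_pad m (s : 'S_m) a b i : i < m ->
  nth 0 (a :: [seq v.+1 | v <- word s] ++ [:: b]) i.+1 = (wv s i).+1.
Proof. by move=> lt_im; rewrite /= nth_cat size_map size_word lt_im (nth_map 0) ?size_word. Qed.

Lemma nth_pad_last m (s : 'S_m) a b :
  nth 0 (a :: [seq v.+1 | v <- word s] ++ [:: b]) m.+1 = b.
Proof. by rewrite /= nth_cat size_map size_word ltnn subnn. Qed.

(** The padding excludes both ends: nothing descends from the front [0] or to the final [m.+1]. *)
Lemma lddE m (s : 'S_m) : ldd s = \sum_(0 <= i < m.-2)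
  ((wv s i.+2 < wv s i.+1) && (wv s i.+1 < wv s i)).
Proof.
rewrite /ldd big_add1 -[m.+1.-1]/m; case: m s => [|m] s; first by rewrite !big_geq.
rewrite big_nat_recl // [X in X + _](_ : _ = 0) ?add0n; last first.
  by rewrite /padL nth_pad.
case: m s => [|m] s; first by rewrite !big_geq.
rewrite big_nat_recr // -[RHS]addn0; congr (_ + _); last first.
  rewrite /padL nth_pad_last nth_pad // !ltnS andbC ltnNge.
  by rewrite (leq_trans (ltnW (wv_lt s (leqnn _)))).
rewrite big_nat [RHS]big_nat; apply: eq_bigr => i /andP [_ lt_im].
by rewrite /padL !nth_pad ?ltnS 1?andbC //; lia.
Qed.

Lemma rdaE m (s : 'S_m) : rda s = \sum_(0 <= i < m.-2)
  ((wv s i < wv s i.+1) && (wv s i.+1 < wv s i.+2)).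
Proof.
rewrite /rda big_add1 -[m.+1.-1]/m; case: m s => [|m] s; first by rewrite !big_geq.
rewrite big_nat_recl // [X in X + _](_ : _ = 0) ?add0n; last first.
  by rewrite /padR nth_pad //= ltnS ltnNge (ltnW (wv_lt s _)).
case: m s => [|m] s; first by rewrite !big_geq.
rewrite big_nat_recr // -[RHS]addn0; congr (_ + _); last first.
  by rewrite /padR nth_pad_last nth_pad // andbC.
rewrite big_nat [RHS]big_nat; apply: eq_bigr => i /andP [_ lt_im].
by rewrite /padR !nth_pad ?ltnS //; lia.
Qed.

Lemma ldd_word m (s : 'S_m) : ldd s = seq_dd (word s).
Proof. by rewrite seq_ddE size_word lddE. Qed.

(** * Patterns, vincular patterns and symmetries *)

Local Open Scope nat_scope.

(** Each pair is compared in both directions because [occurs_at] tests all ordered pairs. *)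
Definition ord3 a b c x y z :=
  [&& (x < y) == (a < b), (y < x) == (b < a), (x < z) == (a < c),
      (z < x) == (c < a), (y < z) == (b < c) & (z < y) == (c < b)].

Lemma containsP m (s : 'S_m) a b c :
  reflect (exists i j k : 'I_m, [/\ i < j, j < k & ord3 a b c (s i) (s j) (s k)])
          (contains s [:: a; b; c]).
Proof.
apply: (iffP existsP) => [[f /forallP occ]|[i [j [k [lt_ij lt_jk]]]]].
  have o (p q : 'I_3) : ((p < q) ==> (f p < f q)) &&
     ((s (f p) < s (f q)) == (nth 0 [:: a; b; c] p < nth 0 [:: a; b; c] q)).
    exact: (forallP (occ p) q).
  pose p0 : 'I_3 := @Ordinal 3 0 isT; pose p1 : 'I_3 := @Ordinal 3 1 isT.
  pose p2 : 'I_3 := @Ordinal 3 2 isT.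
  exists (f p0), (f p1), (f p2).
  have /andP [/= -> /= o01] := o p0 p1; have /andP [/= _ /= o10] := o p1 p0.
  have /andP [/= _ /= o02] := o p0 p2; have /andP [/= _ /= o20] := o p2 p0.
  have /andP [/= -> /= o12] := o p1 p2; have /andP [/= _ /= o21] := o p2 p1.
  by split=> //; apply/and5P; split=> //; apply/andP.
case/and5P=> o01 o10 o02 o20 /andP [o12 o21].
exists [ffun p : 'I_3 => nth i [:: i; j; k] p]; apply/forallP => p; apply/forallP => q.
rewrite !ffunE.
have lt_ik := ltn_trans lt_ij lt_jk.
by case: p => [[|[|[|?]]] //= ?]; case: q => [[|[|[|?]]] //= ?];
  rewrite ?ltnn ?lt_ij ?lt_jk ?lt_ik //=.
Qed.

Lemma avoidsP m (s : 'S_m) a b c :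
  reflect (forall i j k : 'I_m, i < j -> j < k -> ~~ ord3 a b c (s i) (s j) (s k))
          (avoids s [:: a; b; c]).
Proof.
apply: (iffP idP) => [/containsP no i j k lt_ij lt_jk|no].
  by apply/negP => o; apply: no; exists i, j, k.
by apply/containsP => -[i [j [k [lt_ij lt_jk]]]]; apply/negP/no.
Qed.

Lemma subseq3_nth x y z (w : seq nat) :
  subseq [:: x; y; z] w <->
  exists i j k, [/\ i < j, j < k, k < size w &
                    [:: x; y; z] = [:: nth 0 w i; nth 0 w j; nth 0 w k]].
Proof.
split=> [/subseqP [mk _]|[i [j [k [lt_ij lt_jk lt_k ->]]]]].
  (* The word is the image of its list of indices, so masking that list yields the increasing
     triple. *)
  rewrite -{1}[w](mkseq_nth 0) -map_mask.
  have : subseq (mask mk (iota 0 (size w))) (iota 0 (size w)) by exact: mask_subseq.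
  case: (mask _ _) => [|i [|j [|k [|? ?]]]] // sub [-> -> ->].
  have /and3P [lt_ij lt_jk _] := subseq_sorted ltn_trans sub (iota_ltn_sorted _ _).
  have [_ _] := sub3_mem sub; rewrite mem_iota => lt_k.
  by exists i, j, k.
rewrite -[w in subseq _ w](mkseq_nth 0) -[[:: _; _; _]]/(map (nth 0 w) [:: i; j; k]).
apply: map_subseq; rewrite (_ : [:: i; j; k] = [seq x <- iota 0 (size w) | x \in [:: i; j; k]]).
  exact: filter_subseq.
apply: (irr_sorted_eq ltn_trans ltnn); rewrite ?sorted_filter ?iota_ltn_sorted //=.
- by rewrite lt_ij lt_jk.
- exact: ltn_trans.
move=> v; rewrite mem_filter mem_iota /= !inE; case: eqP => [->|_]; last case: eqP => [->|_]; last case: eqP => [->|_] //=; lia.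
Qed.

Lemma avoids_av3 m (s : 'S_m) a b c :
  avoids s [:: a; b; c] <-> av3 (ord3 a b c) (word s).
Proof.
split=> [/avoidsP no x y z /subseq3_nth [i [j [k [lt_ij lt_jk lt_k [-> -> ->]]]]]|av].
  rewrite size_word in lt_k; have lt_j := ltn_trans lt_jk lt_k; have lt_i := ltn_trans lt_ij lt_j.
  have := no (Ordinal lt_i) (Ordinal lt_j) (Ordinal lt_k) lt_ij lt_jk.
  by rewrite -!wvE.
apply/avoidsP => i j k lt_ij lt_jk; rewrite -!wvE; apply: av; apply/subseq3_nth.
by exists i, j, k; rewrite size_word.
Qed.

Lemma av3_eq P Q w : (forall x y z, P x y z = Q x y z) -> av3 P w <-> av3 Q w.
Proof. by move=> PQ; split=> av x y z /av; rewrite PQ. Qed.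

Lemma avoids321 m (s : 'S_m) : avoids s [:: 3; 2; 1] <-> av3 is321 (word s).
Proof. by rewrite avoids_av3; apply: av3_eq => x y z; rewrite /ord3 /is321 /=; lia. Qed.

Lemma avoids231 m (s : 'S_m) : avoids s [:: 2; 3; 1] <-> av3 is231 (word s).
Proof. by rewrite avoids_av3; apply: av3_eq => x y z; rewrite /ord3 /is231 /=; lia. Qed.

(** * Complement and reverse-complement *)

Definition compl m (s : 'S_m) : 'S_m := (s * perm (@rev_ord_inj m))%g.
Definition revcompl m (s : 'S_m) : 'S_m :=
  (perm (@rev_ord_inj m) * s * perm (@rev_ord_inj m))%g.

Lemma compl_inj m : injective (@compl m).
Proof. exact: mulIg. Qed.

Lemma revcompl_inj m : injective (@revcompl m).
Proof. by move=> s s' /mulIg /mulgI. Qed.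

Lemma complE m (s : 'S_m) i : compl s i = rev_ord (s i).
Proof. by rewrite permM permE. Qed.

Lemma revcomplE m (s : 'S_m) i : revcompl s i = rev_ord (s (rev_ord i)).
Proof. by rewrite !permM !permE. Qed.

Lemma wv_compl m (s : 'S_m) i : i < m -> wv (compl s) i = m.-1 - wv s i.
Proof.
move=> lt_im; rewrite (wvE (compl s) (Ordinal lt_im)) complE /=.
by rewrite -(wvE s (Ordinal lt_im)) /=; have := wv_lt s lt_im; lia.
Qed.

Lemma wv_revcompl m (s : 'S_m) i : i < m -> wv (revcompl s) i = m.-1 - wv s (m.-1 - i).
Proof.
move=> lt_im; rewrite (wvE (revcompl s) (Ordinal lt_im)) revcomplE /=.
rewrite -wvE /= (_ : m - i.+1 = m.-1 - i); last lia.
have lt_i : m.-1 - i < m by lia.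
by have := wv_lt s lt_i; lia.
Qed.

Lemma avoids_compl m (s : 'S_m) a b c a' b' c' :
  (forall x y z, x < m -> y < m -> z < m ->
     ord3 a' b' c' (m - x.+1) (m - y.+1) (m - z.+1) = ord3 a b c x y z) ->
  avoids (compl s) [:: a'; b'; c'] = avoids s [:: a; b; c].
Proof.
move=> eq_o; apply/avoidsP/avoidsP => no i j k lt_ij lt_jk.
  by have := no i j k lt_ij lt_jk; rewrite !complE /= eq_o.
by rewrite !complE /= eq_o //; exact: no.
Qed.

Lemma avoids_revcompl m (s : 'S_m) a b c a' b' c' :
  (forall x y z, x < m -> y < m -> z < m ->
     ord3 a' b' c' (m - z.+1) (m - y.+1) (m - x.+1) = ord3 a b c x y z) ->
  avoids (revcompl s) [:: a'; b'; c'] = avoids s [:: a; b; c].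
Proof.
move=> eq_o; apply/avoidsP/avoidsP => no i j k lt_ij lt_jk.
  have := no (rev_ord k) (rev_ord j) (rev_ord i).
  rewrite !revcomplE !rev_ordK /= eq_o //; apply; have := ltn_ord k; lia.
rewrite !revcomplE /= eq_o //; apply: no => /=; have := ltn_ord k; lia.
Qed.

Lemma sum_between m a b : a <= m ->
  \sum_(0 <= v < m) ((b < v) && (v < a)) = a - b.+1.
Proof.
move=> le_am.
(* The induction on [m] needs a form without [a <= m]. *)
suff -> : \sum_(0 <= v < m) ((b < v) && (v < a)) = minn a m - b.+1 by rewrite (minn_idPl le_am).
elim: m {le_am} => [|m IH]; first by rewrite big_geq //; lia.
by rewrite big_nat_recr //= IH; lia.
Qed.

Lemma sum_wv_between m (s : 'S_m) a b : a <= m ->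
  \sum_(r < m) ((b < wv s r) && (wv s r < a)) = a - b.+1.
Proof.
move=> le_am; rewrite -(sum_between b le_am) big_mkord [RHS](reindex_inj (@perm_inj _ s)) /=.
by apply: eq_bigr => r _; rewrite wvE.
Qed.

(** The values strictly between the two letters of a descent number one less than its drop, and each
    stands to the left (2-31) or to the right (31-2) of the descent; [des] supplies the missing
    ones. *)
Lemma vincular_descents m (s : 'S_m) : p31_2 s + p2_31 s + des s = drops s.
Proof.
rewrite /p31_2 /p2_31 /des /drops -big_split /=.
case: m s => [|m] s; first by rewrite big_ord0 !big_geq.
rewrite big_ord_recr /= [X in _ + X + _](_ : _ = 0) ?addn0; last first.
  rewrite big1 => [|r _]; last first.
    by have /negPf -> : ~~ (m.+1 < r) by rewrite -leqNgt ltnW ?ltn_ord.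
  by rewrite big1 // => r _; rewrite ltnn andbF.
rewrite -(big_mkord xpredT (fun p : nat => \sum_(r < m.+1) [&& p.+1 < r, wv s p.+1 < wv s r & wv s r < wv s p] +
  \sum_(r < m.+1) [&& r < p, p.+1 < m.+1, wv s p.+1 < wv s r & wv s r < wv s p])).
rewrite -big_split /= !big_nat; apply: eq_bigr => p /andP [_ lt_pm].
rewrite -big_split /= (eq_bigr (fun r : 'I_m.+1 => (wv s p.+1 < wv s r) && (wv s r < wv s p) : nat)); last first.
  move=> r _; rewrite ltnS lt_pm /=.
  have [->|neq_rp] := eqVneq (r : nat) p; first by lia.
  have [->|neq_rp1] := eqVneq (r : nat) p.+1; first by lia.
  by lia.
rewrite sum_wv_between; first by lia.
by apply/ltnW/wv_lt/ltnW.
Qed.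

Lemma p2_31_av m (s : 'S_m) : avoids s [:: 2; 3; 1] -> p2_31 s = 0.
Proof.
move/avoidsP=> no; rewrite /p2_31 big1 // => p _; rewrite big1 // => r _.
apply/eqP; rewrite eqb0; apply/negP => /and4P [lt_rp lt_pm].
rewrite (wvE s (Ordinal lt_pm)) !wvE => lt1 lt2.
by have /negP := no r p (Ordinal lt_pm) lt_rp (leqnn _); apply; rewrite /ord3; lia.
Qed.

Lemma p31_2_av m (s : 'S_m) : avoids s [:: 3; 1; 2] -> p31_2 s = 0.
Proof.
move/avoidsP=> no; rewrite /p31_2 big1 // => p _; rewrite big1 // => r _.
apply/eqP; rewrite eqb0; apply/negP => /and3P [lt_pr].
have lt_pm : p.+1 < m := ltn_trans lt_pr (ltn_ord r).
rewrite (wvE s (Ordinal lt_pm)) !wvE => lt1 lt2.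
by have /negP := no p (Ordinal lt_pm) r (leqnn _) lt_pr; apply; rewrite /ord3; lia.
Qed.

Lemma p13_2_compl m (s : 'S_m) : p13_2 (compl s) = p31_2 s.
Proof.
apply: eq_bigr => p _; apply: eq_bigr => r _; case: ltnP => //= lt_pr.
have lt_pm : p.+1 < m := ltn_trans lt_pr (ltn_ord r).
rewrite !wv_compl //.
by have := wv_lt s (ltn_ord p); have := wv_lt s (ltn_ord r); have := wv_lt s lt_pm; lia.
Qed.

Lemma p2_13_compl m (s : 'S_m) : p2_13 (compl s) = p2_31 s.
Proof.
apply: eq_bigr => p _; apply: eq_bigr => r _; case: ltnP => //= lt_rp; case: ltnP => //= lt_pm.
rewrite !wv_compl //.
by have := wv_lt s (ltn_ord p); have := wv_lt s (ltn_ord r); have := wv_lt s lt_pm; lia.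
Qed.

Lemma asc_compl m (s : 'S_m) : asc (compl s) = des s.
Proof.
rewrite /asc /des !big_nat; apply: eq_bigr => i /andP [_ lt_im].
have lt_i1 : i.+1 < m by lia.
rewrite !wv_compl ?(ltnW lt_i1) //.
by have := wv_lt s lt_i1; have := wv_lt s (ltnW lt_i1); lia.
Qed.

Lemma rda_compl m (s : 'S_m) : rda (compl s) = ldd s.
Proof.
rewrite rdaE lddE !big_nat; apply: eq_bigr => i /andP [_ lt_im].
have lt_i2 : i.+2 < m by lia.
have lt_i1 := ltnW lt_i2; have lt_i0 := ltnW lt_i1.
rewrite !wv_compl //.
by have := wv_lt s lt_i2; have := wv_lt s lt_i1; have := wv_lt s lt_i0; lia.
Qed.

Lemma des_revcompl m (s : 'S_m) : des (revcompl s) = des s.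
Proof.
rewrite /des big_nat_rev /= !big_nat; apply: eq_bigr => i /andP [_ lt_im].
have lt_i1 : i.+1 < m by lia.
rewrite !wv_revcompl; try lia.
rewrite (_ : m.-1 - (0 + m.-1 - i.+1) = i.+1); last lia.
rewrite (_ : m.-1 - (0 + m.-1 - i.+1).+1 = i); last lia.
by have := wv_lt s lt_i1; have := wv_lt s (ltnW lt_i1); lia.
Qed.

Lemma drops_revcompl m (s : 'S_m) : drops (revcompl s) = drops s.
Proof.
rewrite /drops big_nat_rev /= !big_nat; apply: eq_bigr => i /andP [_ lt_im].
have lt_i1 : i.+1 < m by lia.
rewrite !wv_revcompl; try lia.
rewrite (_ : m.-1 - (0 + m.-1 - i.+1) = i.+1); last lia.
rewrite (_ : m.-1 - (0 + m.-1 - i.+1).+1 = i); last lia.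
by have := wv_lt s lt_i1; have := wv_lt s (ltnW lt_i1); lia.
Qed.

Lemma ldd_revcompl m (s : 'S_m) : ldd (revcompl s) = ldd s.
Proof.
rewrite !lddE big_nat_rev /= !big_nat; apply: eq_bigr => i /andP [_ lt_im].
have lt_i2 : i.+2 < m by lia.
have lt_i1 := ltnW lt_i2; have lt_i0 := ltnW lt_i1.
rewrite !wv_revcompl; try lia.
rewrite (_ : m.-1 - (0 + m.-2 - i.+1) = i.+2); last lia.
rewrite (_ : m.-1 - (0 + m.-2 - i.+1).+1 = i.+1); last lia.
rewrite (_ : m.-1 - (0 + m.-2 - i.+1).+2 = i); last lia.
by have := wv_lt s lt_i2; have := wv_lt s lt_i1; have := wv_lt s lt_i0; lia.
Qed.

(** * Generating functions *)

Local Open Scope ring_scope.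

(** At [lo = 0] with nothing pending, the states are the words of the 321-avoiding permutations, and
    the normalising power of [q] is trivial. *)
Lemma sum_avoids321 (R : comNzRingType) (t q c : R) m :
  \sum_(s : 'S_m | avoids s [:: 3; 2; 1]%N) t ^+ exc s * q ^+ Defs.inv s * c ^+ cda s =
  motz (fun h => t * q ^+ h.+1)
       (fun h => q ^+ h + (if h is h'.+1 then c * t * q ^+ h else 0))
       (fun h => q ^+ h) m 0.
Proof.
have p0 : pending 0 [::] by [].
have stateE u : (u \in states321 m 0 [::]) <-> u.1 = [::] /\
    (perm_eq u.2 (iota 0 m) /\ av3 is321 u.2).
  split=> [/(states321_sound p0) [/size0nil u1 pm _ _ av]|[u1 [pm av]]].
    by move: pm av; rewrite u1.
  by apply: states321_complete => //; split; rewrite u1.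
pose F w := t ^+ seq_exc 0 w * q ^+ seq_inv w * c ^+ seq_cda 0 [::] w.
rewrite (eq_bigr (F \o @word m)) => [|s _]; last by rewrite exc_word inv_word cda_word.
rewrite /comp (@sum_word _ _ _ [seq u.2 | u <- states321 m 0 [::]]).
- have := sum_states321 t q c m p0.
  rewrite /= mul1r => <-; rewrite big_map; apply: eq_big_seq => u /stateE [u1 _].
  by rewrite /weight321 u1.
- rewrite map_inj_in_uniq ?states321_uniq // => -[xs w] [xs' w'].
  by move=> /stateE [/= -> _] /stateE [/= -> _] ->.
- by move=> _ /mapP [u /stateE [_ [pm _]] ->].
move=> s; apply/idP/mapP => [/avoids321 av|[u /stateE [_ [_ av]] ws]].
  by exists ([::], word s) => //; apply/stateE; rewrite perm_word.
by apply/avoids321; rewrite ws.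
Qed.

Lemma sum_avoids231 (R : comNzRingType) (t q : R) m :
  \sum_(s : 'S_m | avoids s [:: 2; 3; 1]%N && (ldd s == 0%N)) t ^+ des s * q ^+ drops s =
  motz (fun h => t * q ^+ h.+1) (fun h => q ^+ h) (fun h => q ^+ h) m 0.
Proof.
have stateE u : (u \in states231 m 0 0) <-> u.1 = [::] /\
    [/\ perm_eq u.2 (iota 0 m), av3 is231 u.2 & seq_dd u.2 = 0%N].
  split=> [/states231_sound [/size0nil u1 pm _ av dd]|[u1 [pm av dd]]].
    by move: pm av; rewrite u1.
  by apply: states231_complete; split; rewrite // u1.
pose F w := t ^+ seq_des w * q ^+ seq_drop w.
rewrite (eq_bigr (F \o @word m)) => [|s _]; last by rewrite des_word drops_word.
rewrite /comp (@sum_word _ _ _ [seq u.2 | u <- states231 m 0 0]).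
- rewrite -(sum_states231 t q m 0 0) big_map; apply: eq_big_seq => u /stateE [u1 _].
  by rewrite /weight231 u1 big_nil.
- rewrite map_inj_in_uniq ?states231_uniq // => -[xs w] [xs' w'].
  by move=> /stateE [/= -> _] /stateE [/= -> _] ->.
- by move=> _ /mapP [u /stateE [_ [pm _ _]] ->].
move=> s; apply/andP/mapP => [[/avoids231 av /eqP dd]|[u /stateE [_ [_ av dd]] ws]].
  by exists ([::], word s) => //; apply/stateE; split=> //; split; rewrite ?perm_word // -ldd_word.
by rewrite ldd_word ws dd; split=> //; apply/avoids231; rewrite ws.
Qed.

Lemma coef_gf (R : comNzRingType) (T : finType) (P : pred T) (e f : T -> nat) (q : R) k :
  (\sum_(s | P s) 'X^(e s) * q%:P ^+ f s)`_k = \sum_(s | P s && (e s == k)) q ^+ f s.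
Proof.
rewrite coef_sum [RHS]big_mkcondr; apply: eq_bigr => s _.
by rewrite -rmorphXn /= coefMC coefXn eq_sym; case: eqP => _; rewrite ?mul1r ?mul0r.
Qed.

(** Setting [c = 0] keeps the permutations with [cda] zero and, on the path side, deletes the second
    kind of level step. *)
Lemma coef_motzX (R : comUnitRingType) (q : R) m k : (motzX q m 0)`_k = gamma m k q.
Proof.
have := sum_avoids321 'X q%:P 0 m; rewrite (@eq_motz _ _ (fun h => 'X * q%:P ^+ h.+1)
  _ (fun h => q%:P ^+ h) _ (fun h => q%:P ^+ h)) //; last first.
  by case=> [|h]; rewrite ?mul0r addr0.
rewrite -/(motzX q m 0) => <-.
rewrite (eq_bigr (fun s => if cda s == 0%N then 'X^(exc s) * q%:P ^+ Defs.inv s else 0)); last first.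
  by move=> s _; rewrite expr0n; case: eqP => _; rewrite ?mulr1 ?mulr0.
rewrite -big_mkcondr coef_gf /gamma; apply: eq_bigl => s.
by rewrite inE -andbA [X in _ && X]andbC.
Qed.

(** Both sides are the coefficient of ['X^k] in the same path polynomial. *)
Lemma gamma_231 (R : comUnitRingType) (q : R) m k :
  gamma m k q = \sum_(s : 'S_m | (avoids s [:: 2; 3; 1]%N && (ldd s == 0%N)) && (des s == k))
                  q ^+ drops s.
Proof. by rewrite -coef_gf sum_avoids231 coef_motzX. Qed.

(** Reverse-complement exchanges 231 and 312 and preserves [des], [ldd] and [drops]. *)
Lemma gamma_312 (R : comUnitRingType) (q : R) m k :
  gamma m k q = \sum_(s : 'S_m | (avoids s [:: 3; 1; 2]%N && (ldd s == 0%N)) && (des s == k))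
                  q ^+ drops s.
Proof.
rewrite gamma_231 [RHS](reindex_inj (@revcompl_inj m)); apply: eq_big => s.
  rewrite ldd_revcompl des_revcompl (@avoids_revcompl _ _ 2 3 1) // => x y z.
  by rewrite /ord3 /=; lia.
by rewrite drops_revcompl.
Qed.

Theorem theorem3p13 (R : comUnitRingType) (n : nat) (t q : R) :
  (1 <= n)%N ->
  (q \is a GRing.unit ->
    Nn_shift n t q =
    \sum_(k < (n.-1)./2.+1) gamma n.-1 k q * t ^+ k * (1 + t) ^+ (n.-1 - k.*2))
  /\
  (forall k : nat, (k <= (n.-1)./2)%N ->
    gamma n.-1 k q = \sum_(s in Stilde231 n.-1 k) q ^+ (p31_2 s + des s) /\
    gamma n.-1 k q = \sum_(s in Stilde312 n.-1 k) q ^+ (p2_31 s + des s) /\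
    gamma n.-1 k q = \sum_(s in Stilde132 n.-1 k) q ^+ (p2_13 s + asc s) /\
    gamma n.-1 k q = \sum_(s in Stilde213 n.-1 k) q ^+ (p13_2 s + asc s)).
Proof.
case: n => // m _; rewrite [m.+1.-1]/=; split=> [q_unit|k _].
  rewrite /Nn_shift.
  (* The trivial factor for [fixp] is traded for [1 ^+ cda s], so that the generating function
     applies with [c = 1]. *)
  under eq_bigr => s _ do rewrite expr1n -(expr1n R (cda s)).
  rewrite sum_avoids321 (@eq_motz _ _ (fun h => t * q ^+ h) _
    (fun h => q ^+ h + (if h is h'.+1 then t * q ^+ h' else 0)) _ (fun h => q ^+ h)) //.
  (* At height [0] the regrouping leaves a single path sum of length [m] with level weight
     [1 + t]. *)
  - rewrite motz_shift /= mul1r addr0 (@motz_homog _ q t (1 + t) m 0 (m./2.+1)); last lia.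
    by apply: eq_bigr => k _; rewrite coef_motzX subn0.
  (* Dividing [t] by [q] lowers the power of [q] on a rise by one, which is where [q] must be a
     unit. *)
  - by move=> h; rewrite exprS -mulrA mulKr.
  - by case=> // h; rewrite mul1r exprS -mulrA mulKr.
have des231 (s : 'S_m) : avoids s [:: 2; 3; 1]%N -> drops s = (p31_2 s + des s)%N.
  by move=> av; rewrite -vincular_descents (p2_31_av av) addn0.
have des312 (s : 'S_m) : avoids s [:: 3; 1; 2]%N -> drops s = (p2_31 s + des s)%N.
  by move=> av; rewrite -vincular_descents (p31_2_av av) add0n.
repeat split.
- rewrite gamma_231; apply: eq_big => s; first by rewrite inE -andbA [X in _ && X]andbC.
  by case/andP=> /andP [/des231 -> _].
- rewrite gamma_312; apply: eq_big => s; first by rewrite inE -andbA [X in _ && X]andbC.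
  by case/andP=> /andP [/des312 -> _].
(* Complement takes 312 to 132, and 2-31, [des], [ldd] to 2-13, [asc], [rda]; below it takes 231 to
   213 and 31-2 to 13-2. *)
- rewrite gamma_312 [RHS](reindex_inj (@compl_inj m)); apply: eq_big => s.
    rewrite inE rda_compl asc_compl (@avoids_compl _ _ 3 1 2) => [|x y z].
      by rewrite -andbA [X in _ && X]andbC.
    by rewrite /ord3 /=; lia.
  by case/andP=> /andP [/des312 -> _]; rewrite p2_13_compl asc_compl.
- rewrite gamma_231 [RHS](reindex_inj (@compl_inj m)); apply: eq_big => s.
    rewrite inE rda_compl asc_compl (@avoids_compl _ _ 2 3 1) => [|x y z].
      by rewrite -andbA [X in _ && X]andbC.
    by rewrite /ord3 /=; lia.
  by case/andP=> /andP [/des231 -> _]; rewrite p13_2_compl asc_compl.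
Qed.
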